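(* Let $G$ be a profinite group that is not Fitting-regular. Then there is a normal subgroup $N$ of $G$ such that $G/N$ is non-trivial, countably based and Fitting-degenerate.
   Context: Profinite groups are regarded as topological groups: subgroups are required to be closed, homomorphisms continuous, and generation means topological generation. For a profinite group $G$ and a prime $p$, $O_p(G)$ is the subgroup generated by all normal pro-$p$ subgroups of $G$; the Fitting subgroup $F(G)$ is the subgroup generated by the $O_p(G)$ for all primes $p$. A profinite group $Q$ is quasisimple if $Q$ is perfect and $Q/Z(Q)$ is simple. A component of $G$ is a subnormal quasisimple subgroup of $G$; the layer $E(G)$ is the subgroup generated by all components of $G$. The generalised Fitting subgroup $F^*(G)$ is the subgroup generated by $F(G)$ and $E(G)$. $G$ is Fitting-degenerate if $F^*(G)$ is trivial. $G$ is Fitting-regular if no non-trivial image (quotient by a closed normal subgroup) of $G$ is Fitting-degenerate. *)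

(* Defs.v *)
From HB Require Import structures.
From mathcomp Require Import all_boot all_classical.
From mathcomp Require Import topology.

Set Implicit Arguments.
Unset Strict Implicit.
Unset Printing Implicit Defensive.

Import Algebra.

Local Open Scope classical_set_scope.
Local Open Scope group_scope.

HB.structure Definition PreTopologicalGroup := {G of Topological G & Group G}.

HB.mixin Record PreTopologicalGroup_isTopologicalGroup G
    of PreTopologicalGroup G := {
  mulg_continuous : continuous (fun xy : G * G => xy.1 * xy.2);
  invg_continuous : continuous (fun x : G => x^-1)
}.

#[short(type="topologicalGroupType")]
HB.structure Definition TopologicalGroup :=
  {G of PreTopologicalGroup G & PreTopologicalGroup_isTopologicalGroup G}.

Definition profinite (G : topologicalGroupType) : Prop :=
  [/\ compact [set: G], hausdorff_space G & totally_disconnected [set: G]].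

(* Subgroups are bundled without a closedness condition, so that quotients can
   be formed without separation hypotheses; [closed] is a separate condition.
   Open subgroups, and the center of a Hausdorff group, are closed anyway. *)
Record subgroup (G : topologicalGroupType) := Subgroup {
  subgroup_set :> set G;
  subgroup_groupP : group_closed [in subgroup_set]
}.

Definition is_normal (G : topologicalGroupType) (N : subgroup G) : Prop :=
  forall x y : G, (N : set G) x -> (N : set G) (x ^ y).

Record normal_subgroup (G : topologicalGroupType) := NormalSubgroup {
  normal_subgroup_subgroup :> subgroup G;
  normal_subgroupP : is_normal normal_subgroup_subgroup
}.

Definition subgroup_type (G : topologicalGroupType) (H : subgroup G) : Type :=
  set_type H.

Section SubgroupType.
Variables (G : topologicalGroupType) (H : subgroup G).
Local Notation T := (subgroup_type H).

HB.instance Definition _ := SubChoice.copy T (set_type H).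
HB.instance Definition _ := Topological.copy T (set_type H).
HB.instance Definition _ := SubChoice_isSubGroup.Build G [in (H : set G)] T
  (subgroup_groupP H).

Lemma subgroup_val_continuous : continuous (val : T -> G).
Proof. exact: initial_continuous. Qed.

Lemma subgroup_continuous (S : topologicalType) (f : S -> T) :
  continuous (val \o f) -> continuous f.
Proof.
move=> /continuousP cf; apply/continuousP => _ [A oA <-].
by rewrite -comp_preimage; exact: cf.
Qed.

Lemma subgroup_mulg_continuous : continuous (fun xy : T * T => xy.1 * xy.2).
Proof.
apply: subgroup_continuous => xy.
rewrite (_ : _ \o _ = (fun z : G * G => z.1 * z.2) \o
  (fun z : T * T => (val z.1, val z.2))); last first.
  by apply/funext => z; exact: (valM z.1 z.2).
apply: continuous_comp; last exact: mulg_continuous.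
apply: cvg_pair => /=.
  by apply: continuous_comp; [exact: cvg_fst | exact: subgroup_val_continuous].
by apply: continuous_comp; [exact: cvg_snd | exact: subgroup_val_continuous].
Qed.

Lemma subgroup_invg_continuous : continuous (fun x : T => x^-1).
Proof.
apply: subgroup_continuous => x.
rewrite (_ : _ \o _ = (fun z : G => z^-1) \o (val : T -> G)); last first.
  by apply/funext => z; exact: (gmulfV (val : T -> G)).
by apply: continuous_comp;
  [exact: subgroup_val_continuous | exact: invg_continuous].
Qed.

HB.instance Definition _ := PreTopologicalGroup_isTopologicalGroup.Build T
  subgroup_mulg_continuous subgroup_invg_continuous.

End SubgroupType.

Section QuotientGroup.
Local Open Scope quotient_scope.
Variables (G : topologicalGroupType) (N : normal_subgroup G).

Definition coset_rel (x y : G) : bool := x^-1 * y \in (N : set G).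

Lemma coset_rel_equiv : equiv_class_of coset_rel.
Proof.
have [N1 NF] := subgroup_groupP N.
have NV : {in [in (N : set G)], forall u, u^-1 \in [in (N : set G)]}.
  exact: (group_closedV (subgroup_groupP N)).
have NM := group_closedM (subgroup_groupP N).
split=> [x|x y|y x z]; rewrite /coset_rel.
- by rewrite mulVg.
- by apply/idP/idP => /NV; rewrite invgM invgK.
- move=> xy yz; have := NM _ _ xy yz.
  by rewrite mulgA mulgK.
Qed.

Canonical coset_rel_equiv_rel := EquivRelPack coset_rel_equiv.

Definition quotient_group : Type := quotient_topology {eq_quot coset_rel}.
Local Notation Q := quotient_group.

HB.instance Definition _ := Topological.copy Q
  (quotient_topology {eq_quot coset_rel}).
HB.instance Definition _ := Quotient.copy Q
  (quotient_topology {eq_quot coset_rel}).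

Definition coset (x : G) : Q := \pi x.

Lemma coset_reprK (x : Q) : coset (repr x) = x.
Proof. exact: reprK. Qed.

Lemma cosetP (x y : G) : coset x = coset y <-> (N : set G) (x^-1 * y).
Proof.
split=> [/eqmodP|xy]; first by rewrite /= /coset_rel inE.
by apply/eqmodP; rewrite /= /coset_rel inE.
Qed.

Definition quotient_one : Q := coset 1.
Definition quotient_mul (x y : Q) : Q := coset (repr x * repr y).
Definition quotient_inv (x : Q) : Q := coset (repr x)^-1.

Lemma cosetM (x y : G) :
  coset (x * y) = quotient_mul (coset x) (coset y).
Proof.
have [_ NF] := subgroup_groupP N.
have NM := group_closedM (subgroup_groupP N).
rewrite /quotient_mul; apply/cosetP.
have /cosetP xx : coset x = coset (repr (coset x)) by rewrite coset_reprK.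
have /cosetP yy : coset y = coset (repr (coset y)) by rewrite coset_reprK.
set x' := repr _ in xx *; set y' := repr _ in yy *.
have -> : (x * y)^-1 * (x' * y') = ((x^-1 * x') ^ y) * (y^-1 * y').
  by rewrite conjgE invgM !mulgA mulgK.
by have := NM _ _ (mem_set (normal_subgroupP y xx)) (mem_set yy); rewrite inE.
Qed.

Lemma cosetV (x : G) : coset x^-1 = quotient_inv (coset x).
Proof.
have NV := group_closedV (subgroup_groupP N).
rewrite /quotient_inv; apply/cosetP.
have /cosetP xx : coset (repr (coset x)) = coset x by rewrite coset_reprK.
set x' := repr _ in xx *.
have -> : x^-1^-1 * x'^-1 = (x'^-1 * x) ^ x'^-1.
  by rewrite conjgE !invgK !mulgA mulgV mul1g.
exact: (normal_subgroupP (x'^-1) xx).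
Qed.

Fact quotient_mulgA : associative quotient_mul.
Proof.
move=> x y z; rewrite -[x]coset_reprK -[y]coset_reprK -[z]coset_reprK.
by rewrite -!cosetM mulgA.
Qed.

Fact quotient_mul1g : left_id quotient_one quotient_mul.
Proof. by move=> x; rewrite -[x]coset_reprK -cosetM mul1g. Qed.

Fact quotient_mulg1 : right_id quotient_one quotient_mul.
Proof. by move=> x; rewrite -[x]coset_reprK -cosetM mulg1. Qed.

Fact quotient_mulVg : left_inverse quotient_one quotient_inv quotient_mul.
Proof. by move=> x; rewrite -[x]coset_reprK -cosetV -cosetM mulVg. Qed.

Fact quotient_mulgV : right_inverse quotient_one quotient_inv quotient_mul.
Proof. by move=> x; rewrite -[x]coset_reprK -cosetV -cosetM mulgV. Qed.

HB.instance Definition _ := isGroup.Build Q quotient_mulgA quotient_mul1g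
  quotient_mulg1 quotient_mulVg quotient_mulgV.

Lemma coset_continuous : continuous (coset : G -> Q).
Proof. exact: pi_continuous. Qed.

Lemma coset_open (U : set G) : open U -> open (coset @` U).
Proof.
move=> oU; change (open (coset @^-1` (coset @` U))).
have -> : coset @^-1` (coset @` U) =
    \bigcup_(n in (N : set G)) ((fun x : G => x * n) @^-1` U).
  apply/seteqP; split=> [x [u Uu /esym/cosetP xu]|x [n Nn Uxn]] /=.
    by exists (x^-1 * u) => //=; rewrite mulgA mulgV mul1g.
  by exists (x * n) => //; apply/esym/cosetP; rewrite mulgA mulVg mul1g.
apply: bigcup_open => n _; apply: open_comp => // x _.
apply: (@continuous_comp _ _ _ (fun x : G => (x, n)) (fun z => z.1 * z.2)).
  by apply: cvg_pair => /=; [exact: cvg_id | exact: cvg_cst].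
exact: mulg_continuous.
Qed.

Lemma coset_nbhs (x : G) (U : set G) :
  nbhs x U -> nbhs (coset x) (coset @` U).
Proof.
rewrite !nbhsE => -[V [oV Vx] VU].
exists (coset @` V); last exact: image_subset.
by split; [exact: coset_open | exists x].
Qed.

Lemma quotient_mulg_continuous : continuous (fun xy : Q * Q => xy.1 * xy.2).
Proof.
move=> [x y]; rewrite -[x]coset_reprK -[y]coset_reprK.
move: (repr x) (repr y) => {x y} a b A /=.
have -> : (coset a * coset b)%g = coset (a * b) by rewrite cosetM.
move=> /coset_continuous/(@mulg_continuous G (a, b)) [[U V] /= [aU bV] UV].
exists (coset @` U, coset @` V) => /=.
  by split; exact: coset_nbhs.
move=> [_ _] [/= [u Uu <-] [v Vv <-]].
by have := UV (u, v) (conj Uu Vv); rewrite /= cosetM.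
Qed.

Lemma quotient_invg_continuous : continuous (fun x : Q => x^-1).
Proof.
apply/quotient_continuous => x.
rewrite (_ : _ \o _ = coset \o (fun z : G => z^-1)); last first.
  by apply/funext => z /=; rewrite cosetV.
by apply: continuous_comp;
  [exact: invg_continuous | exact: coset_continuous].
Qed.

HB.instance Definition _ := PreTopologicalGroup_isTopologicalGroup.Build Q
  quotient_mulg_continuous quotient_invg_continuous.

End QuotientGroup.

Section Notions.
Variable G : topologicalGroupType.

Definition nontrivial : Prop := exists x : G, x != 1.

(* Topological generation: the smallest closed subgroup containing [A]. *)
Definition gen (A : set G) : set G :=
  \bigcap_(H in [set H : subgroup G | closed (H : set G) /\ A `<=` H])
    (H : set G).

Definition perfect : Prop :=
  gen [set [~ x, y] | x in [set: G] & y in [set: G]] = [set: G].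

Definition simple : Prop :=
  nontrivial /\
  forall N : normal_subgroup G, closed (N : set G) ->
    (N : set G) = [set 1] \/ (N : set G) = [set: G].

Definition center_set : set G := [set x | forall y : G, commute x y].

Lemma center_group_closed : group_closed [in center_set].
Proof.
split=> [|x y]; first by rewrite inE => y; exact/commute_sym/commute1.
rewrite !inE => Zx Zy z; apply/commute_sym/commuteM; first exact/commute_sym.
exact/commuteV/commute_sym.
Qed.

Lemma center_is_normal : is_normal (Subgroup center_group_closed).
Proof.
by move=> x y Zx; rewrite conjgE [x * y]Zx mulgA mulVg mul1g.
Qed.

Definition center : normal_subgroup G := NormalSubgroup center_is_normal.

Definition pro_p (p : nat) : Prop :=
  profinite G /\
  forall N : normal_subgroup G, open (N : set G) ->
    exists n : nat, ([set: quotient_group N] #= `I_((p ^ n)%N))%card.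

End Notions.

Definition quasisimple (Q : topologicalGroupType) : Prop :=
  [/\ profinite Q, perfect Q & simple (quotient_group (center Q))].

Section Fitting.
Variable G : topologicalGroupType.

Definition normal_in (H K : set G) : Prop :=
  H `<=` K /\ forall x y : G, H x -> K y -> H (x ^ y).

Definition subnormal (H : subgroup G) : Prop :=
  exists (n : nat) (C : nat -> subgroup G),
    [/\ (C 0 : set G) = H, (C n : set G) = [set: G],
        forall i, (i <= n)%N -> closed (C i : set G) &
        forall i, (i < n)%N -> normal_in (C i) (C i.+1)].

Definition component (H : subgroup G) : Prop :=
  [/\ closed (H : set G), subnormal H & quasisimple (subgroup_type H)].

Definition layer : set G :=
  gen (\bigcup_(H in [set H | component H]) (H : set G)).

Definition p_core (p : nat) : set G :=
  gen (\bigcup_(K in [set K : normal_subgroup G |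
      closed (K : set G) /\ pro_p (subgroup_type K) p]) (K : set G)).

Definition fitting : set G :=
  gen (\bigcup_(p in [set p : nat | prime p]) p_core p).

Definition generalised_fitting : set G := gen (fitting `|` layer).

Definition fitting_degenerate : Prop := generalised_fitting = [set 1].

End Fitting.

Definition fitting_regular (G : topologicalGroupType) : Prop :=
  forall N : normal_subgroup G, closed (N : set G) ->
    nontrivial (quotient_group N) -> ~ fitting_degenerate (quotient_group N).

(* Main.v *)
(* Work with closed normal subgroups N of G and the open normal subgroups M
   containing N.  The quotient G/N is Fitting-degenerate when it has no
   non-trivial normal pro-p subgroup (p prime) and no component; a component is
   recorded together with a subnormal chain C_0, ..., C_n = G ending in it.  For
   each fixed p, respectively each fixed length n, these configurations form an
   inverse system over the M, and a compatible family of them, each surviving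
   modulo a fixed M_0, converges to such a configuration in G/N.  So if G/N_0 is
   Fitting-degenerate, then for every M >= N_0 and every p or n there is M' <= M
   such that all configurations of that kind in G/M' become trivial in G/M.
   Iterating, with every p and n treated infinitely often, gives a descending
   sequence M_0 > M_1 > ...; any configuration modulo N = \bigcap_i M_i pushes
   forward to each G/M_i, where it must vanish, so G/N is Fitting-degenerate,
   and it is countably based by construction.  Keeping the length n of the
   chains fixed makes it unnecessary to know that components are subnormal of
   defect at most two. *)
Require Import Defs.
From HB Require Import structures.
From mathcomp Require Import fingroup cyclic pgroup.
From mathcomp Require Import all_boot all_classical.
From mathcomp Require Import topology.

Set Implicit Arguments.
Unset Strict Implicit.
Unset Printing Implicit Defensive.

Import Algebra.

Local Open Scope classical_set_scope.
Local Open Scope group_scope.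

(** * Subgroups as sets *)

Section SetSubgroups.
Variable G : topologicalGroupType.
Implicit Types (A B D H K L M N : set G) (x y : G).

(** Subgroups are handled as plain sets, so that products, intersections and limits can be formed
    first; [mk_subgroup] and [mk_normal] bundle them where the topological notions ask for
    records. *)
Definition is_subgroup A : Prop :=
  [/\ A 1, (forall x y, A x -> A y -> A (x * y)) &
      (forall x, A x -> A x^-1)].

Definition is_normal_subgroup M : Prop :=
  is_subgroup M /\ forall x y, M x -> M (x ^ y).

(* The product A M, written as a union of left cosets of M. *)
Definition setmul A M : set G := [set x | exists2 a, A a & M (a^-1 * x)].

Lemma is_subgroup_closed A : is_subgroup A -> group_closed [in A].
Proof.
move=> [A1 AM AV]; split; first by rewrite inE.
by move=> x y; rewrite !inE => Ax Ay; exact/AM/AV.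
Qed.

Lemma subgroup_is_subgroup (H : subgroup G) : is_subgroup H.
Proof.
have gH := subgroup_groupP H; have [H1 _] := gH; split.
- by rewrite inE in H1.
- move=> x y Hx Hy.
  by have := group_closedM gH (mem_set Hx) (mem_set Hy); rewrite inE.
- by move=> x Hx; have := group_closedV gH (mem_set Hx); rewrite inE.
Qed.

Lemma normal_is_normal (N : normal_subgroup G) : is_normal_subgroup N.
Proof. by split; [exact: subgroup_is_subgroup | exact: normal_subgroupP]. Qed.

Definition mk_subgroup A (sA : is_subgroup A) : subgroup G :=
  Subgroup (is_subgroup_closed sA).

Definition mk_normal M (nM : is_normal_subgroup M) : normal_subgroup G :=
  @NormalSubgroup G (mk_subgroup nM.1) nM.2.

Lemma is_subgroupI A B : is_subgroup A -> is_subgroup B -> is_subgroup (A `&` B).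
Proof.
move=> [A1 AM AV] [B1 BM BV]; split => //.
- by move=> x y [? ?] [? ?]; split; [exact: AM | exact: BM].
- by move=> x [? ?]; split; [exact: AV | exact: BV].
Qed.

Lemma is_normal_subgroupI M N : is_normal_subgroup M -> is_normal_subgroup N ->
  is_normal_subgroup (M `&` N).
Proof.
move=> [sM nM] [sN nN]; split; first exact: is_subgroupI.
by move=> x y [? ?]; split; [exact: nM | exact: nN].
Qed.

End SetSubgroups.

(** * Images and preimages under group homomorphisms *)

Section Morphisms.
Variables (G1 G2 : topologicalGroupType) (f : G1 -> G2).
Hypothesis fM : forall x y, f (x * y) = f x * f y.

Lemma morph1 : f 1 = 1.
Proof. by apply: (@mulgI _ (f 1)); rewrite -fM !mulg1. Qed.

Lemma morphV x : f x^-1 = (f x)^-1.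
Proof. by apply: (@mulgI _ (f x)); rewrite -fM !mulgV morph1. Qed.

Lemma morphJ x y : f (x ^ y) = f x ^ f y.
Proof. by rewrite !conjgE !fM morphV. Qed.

Lemma morphR x y : f [~ x, y] = [~ f x, f y].
Proof. by rewrite !commgEl fM morphV morphJ. Qed.

Lemma morphX x n : f (x ^+ n) = f x ^+ n.
Proof. by elim: n => [|n IHn]; rewrite ?morph1 // !expgS fM IHn. Qed.

Lemma is_subgroup_preimage A : is_subgroup A -> is_subgroup (f @^-1` A).
Proof.
move=> [A1 AM AV]; split; rewrite /preimage /=; first by rewrite morph1.
- by move=> x y Ax Ay; rewrite fM; exact: AM.
- by move=> x Ax; rewrite morphV; exact: AV.
Qed.

Lemma is_subgroup_image A : is_subgroup A -> is_subgroup (f @` A).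
Proof.
move=> [A1 AM AV]; split; first by exists 1 => //; exact: morph1.
- by move=> _ _ [x Ax <-] [y Ay <-]; exists (x * y); [exact: AM | exact: fM].
- by move=> _ [x Ax <-]; exists x^-1; [exact: AV | exact: morphV].
Qed.

Lemma is_normal_subgroup_preimage A :
  is_normal_subgroup A -> is_normal_subgroup (f @^-1` A).
Proof.
move=> [sA nA]; split; first exact: is_subgroup_preimage.
by move=> x y Ax; rewrite /preimage /= morphJ; exact: nA.
Qed.

Lemma is_normal_subgroup_image A : (forall y, exists x, f x = y) ->
  is_normal_subgroup A -> is_normal_subgroup (f @` A).
Proof.
move=> fS [sA nA]; split; first exact: is_subgroup_image.
move=> _ y [x Ax <-]; have [z <-] := fS y.
by exists (x ^ z); [exact: nA | exact: morphJ].
Qed.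

End Morphisms.

(** * Products with a normal subgroup *)

Section Products.
Variable G : topologicalGroupType.
Implicit Types (A B D H K L M N : set G) (x y : G).

Section ModNormal.
Variables (M : set G) (nM : is_normal_subgroup M).

(** Turns congruence modulo [M] into an equality, so that products, conjugates and commutators are
    compared by rewriting. *)
Definition modg : G -> quotient_group (mk_normal nM) := @coset G (mk_normal nM).

Lemma modP x y : modg x = modg y <-> M (x^-1 * y).
Proof. exact: cosetP. Qed.

Lemma modgM x y : modg (x * y) = modg x * modg y.
Proof. exact: cosetM. Qed.

Lemma modg1 : modg 1 = 1. Proof. by []. Qed.

Lemma modgV x : modg x^-1 = (modg x)^-1.
Proof. exact: morphV modgM x. Qed.

Lemma modgX x n : modg (x ^+ n) = modg x ^+ n.
Proof. exact: morphX modgM x n. Qed.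

Lemma modgJ x y : modg (x ^ y) = modg x ^ modg y.
Proof. exact: morphJ modgM x y. Qed.

Lemma modgR x y : modg [~ x, y] = [~ modg x, modg y].
Proof. exact: morphR modgM x y. Qed.

Lemma mod1P x : modg x = 1 <-> M x.
Proof.
by split=> [/esym|Mx]; [|apply/esym]; rewrite -?modg1; [move/modP|apply/modP];
  rewrite invg1 mul1g.
Qed.

Lemma setmulP A x : setmul A M x <-> exists2 a, A a & modg a = modg x.
Proof. by split=> -[a Aa /modP]; exists a. Qed.

Lemma setmul_congr A x y : modg x = modg y -> setmul A M x -> setmul A M y.
Proof. by move=> xy /setmulP[a Aa ax]; apply/setmulP; exists a; rewrite ?ax. Qed.

Lemma subgroup_mod A x y : is_subgroup A -> M `<=` A ->
  modg x = modg y -> A x -> A y.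
Proof.
move=> [_ AM _] MA /modP/MA Axy Ax.
by have := AM _ _ Ax Axy; rewrite mulVKg.
Qed.

Lemma sub_setmul A : A `<=` setmul A M.
Proof. by move=> a Aa; apply/setmulP; exists a. Qed.

Lemma sub_setmulr A : A 1 -> M `<=` setmul A M.
Proof.
by move=> A1 m Mm; apply/setmulP; exists 1 => //; apply/esym/mod1P.
Qed.

Lemma setmul_subset A B : A `<=` B -> setmul A M `<=` setmul B M.
Proof. by move=> AB x [a Aa ax]; exists a; [exact: AB|]. Qed.

Lemma setmul_min A H : is_subgroup H -> A `<=` H -> M `<=` H ->
  setmul A M `<=` H.
Proof.
by move=> sH AH MH x /setmulP[a /AH Ha ax]; exact: (subgroup_mod sH MH ax).
Qed.

Lemma setmul_id A : is_subgroup A -> M `<=` A -> setmul A M = A.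
Proof.
move=> sA MA; apply/seteqP; split; first exact: setmul_min.
exact: sub_setmul.
Qed.

Lemma setmulT : setmul setT M = setT.
Proof. by apply/seteqP; split => // x _; exact: sub_setmul. Qed.

Lemma is_subgroup_setmul A : is_subgroup A -> is_subgroup (setmul A M).
Proof.
move=> [A1 AM AV]; split.
- exact: sub_setmul.
- move=> x y /setmulP[a Aa ax] /setmulP[b Ab bx]; apply/setmulP.
  by exists (a * b); [exact: AM | rewrite !modgM ax bx].
- move=> x /setmulP[a Aa ax]; apply/setmulP.
  by exists a^-1; [exact: AV | rewrite !modgV ax].
Qed.

Lemma normal_in_setmul A B : normal_in A B ->
  normal_in (setmul A M) (setmul B M).
Proof.
move=> [AB nAB]; split; first exact: setmul_subset.
move=> x y /setmulP[a Aa ax] /setmulP[b Bb by_]; apply/setmulP.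
by exists (a ^ b); [exact: nAB | rewrite !modgJ ax by_].
Qed.

Lemma is_normal_subgroup_setmul A : is_normal_subgroup A ->
  is_normal_subgroup (setmul A M).
Proof.
move=> [sA nA]; split; first exact: is_subgroup_setmul.
move=> x y Ax; have [_] : normal_in (setmul A M) (setmul setT M).
  by apply: normal_in_setmul; split => // u v Au _; exact: nA.
by apply=> //; rewrite setmulT.
Qed.

End ModNormal.

Lemma continuousM (S : topologicalType) (u v : S -> G) :
  continuous u -> continuous v -> continuous (fun s => u s * v s).
Proof.
move=> cu cv s.
apply: (@continuous_comp _ _ _ (fun s => (u s, v s)) (fun z => z.1 * z.2)).
  by apply: cvg_pair => /=; [exact: cu | exact: cv].
exact: mulg_continuous.
Qed.

Lemma continuousJ (S : topologicalType) (u v : S -> G) :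
  continuous u -> continuous v -> continuous (fun s => u s ^ v s).
Proof.
move=> cu cv; apply: (@continuousM _ (fun s => (v s)^-1)).
  by move=> s; apply: continuous_comp; [exact: cv | exact: invg_continuous].
exact: continuousM.
Qed.

Lemma mul_continuousl x : continuous (fun y : G => x * y).
Proof. by apply: continuousM => y; [exact: cvg_cst | exact: cvg_id]. Qed.

Lemma open_coset M x : open M -> open [set y | M (x^-1 * y)].
Proof.
move=> oM; rewrite (_ : [set _ | _] = (fun y => x^-1 * y) @^-1` M) //.
by apply: open_comp => // y _; exact: mul_continuousl.
Qed.

Lemma closed_coset M x : closed M -> closed [set y | M (x^-1 * y)].
Proof.
move=> cM; rewrite (_ : [set _ | _] = (fun y => x^-1 * y) @^-1` M) //.
by apply: preimage_closed => // y _; exact: mul_continuousl.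
Qed.

Lemma nbhs_coset M x : is_subgroup M -> open M -> nbhs x [set y | M (x^-1 * y)].
Proof.
move=> [M1 _ _] oM; apply: open_nbhs_nbhs; split; first exact: open_coset.
by rewrite /= mulVg.
Qed.

Lemma open_setmul A M : is_normal_subgroup M -> open M -> open (setmul A M).
Proof.
move=> nM oM; rewrite (_ : setmul A M = \bigcup_(a in A) [set y | M (a^-1 * y)]).
  by apply: bigcup_open => a _; exact: open_coset.
by apply/seteqP; split=> x [a Aa ax]; exists a.
Qed.

(** The complement of a union of cosets of [M] is again a union of cosets of [M], hence open. *)
Lemma closed_setmul A M : is_normal_subgroup M -> open M -> closed (setmul A M).
Proof.
move=> nM oM; rewrite -[setmul A M]setCK; apply: open_closedC.
rewrite (_ : ~` _ = setmul (~` setmul A M) M); first exact: open_setmul.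
apply/seteqP; split; first exact: sub_setmul.
move=> x /(setmulP nM)[a nAa ax] /(setmul_congr (esym ax)); exact: nAa.
Qed.

Lemma open_subgroup_closed M : is_normal_subgroup M -> open M -> closed M.
Proof.
move=> nM oM; have [sM _] := nM.
by rewrite -(setmul_id nM sM (fun x => id)); exact: closed_setmul.
Qed.

End Products.

(** * Fitting-theoretic notions relative to a normal subgroup *)

Section RelativeNotions.
Variable G : topologicalGroupType.
Implicit Types (A B D H K L M N : set G) (x y : G) (C : nat -> set G).

Definition open_normal_over N M : Prop :=
  [/\ open M, is_normal_subgroup M & N `<=` M].

(* For N <= D this says that D / N is quasisimple: D / N is non-trivial and
   perfect, and its proper closed normal subgroups are central. *)
Definition quasisimple_mod D N : Prop :=
  [/\ ~ D `<=` N,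
      (forall H, closed H -> is_subgroup H -> N `<=` H ->
         (forall x y, D x -> D y -> H [~ x, y]) -> D `<=` H) &
      (forall H, closed H -> is_subgroup H -> N `<=` H -> normal_in H D ->
         D `<=` H \/ forall x y, H x -> D y -> N [~ x, y])].

(* D N / N is pro-p, tested on elements: by Lagrange and Cauchy a finite group is
   a p-group if and only if all its elements have p-power order. *)
Definition pro_p_mod (p : nat) D N : Prop :=
  forall x, D x -> forall M, open_normal_over N M -> exists n, M (x ^+ (p ^ n)%N).

(** [C] is a total sequence: the chain consists of the terms [C 0] to [C n], and later terms are
    only asked to be subgroups. *)
Definition subnormal_chain n C : Prop :=
  [/\ C n = setT, forall i, is_subgroup (C i),
      forall i, (i <= n)%N -> closed (C i) &
      forall i, (i < n)%N -> normal_in (C i) (C i.+1)].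

Lemma open_normal_over_trans N M L : N `<=` M -> open_normal_over M L ->
  open_normal_over N L.
Proof. by move=> NM [oL nL ML]; split => //; exact: subset_trans ML. Qed.

Lemma open_normal_overI N M L : open_normal_over N M -> open_normal_over N L ->
  open_normal_over N (M `&` L).
Proof.
move=> [oM nM NM] [oL nL NL]; split; first exact: openI.
  exact: is_normal_subgroupI.
by move=> x Nx; split; [exact: NM | exact: NL].
Qed.

Lemma comm_mod M (nM : is_normal_subgroup M) a b c d :
  modg nM a = modg nM b -> modg nM c = modg nM d -> M [~ a, c] -> M [~ b, d].
Proof. by move=> ab cd /(mod1P nM); rewrite modgR ab cd -modgR => /(mod1P nM). Qed.

(** D M / M is a non-trivial image of D / N. A normal subgroup H / M of it is controlled by H ∩ D,
    which is normal in D. *)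
Lemma quasisimple_mod_setmul D N M : closed D -> is_subgroup D -> N `<=` D ->
  N `<=` M -> open M -> is_normal_subgroup M -> ~ D `<=` M ->
  quasisimple_mod D N -> quasisimple_mod (setmul D M) M.
Proof.
move=> cD sD ND NM oM nM nDM [_ perfD simD].
have MS : M `<=` setmul D M by apply: (sub_setmulr nM); case: sD.
split=> [DMM|H cH sH MH commH|H cH sH MH [HD nHD]].
- by apply: nDM => x Dx; apply: DMM; exact: sub_setmul.
- apply: setmul_min => //; apply: perfD => //; first exact: subset_trans MH.
  by move=> x y Dx Dy; apply: commH; exact: (sub_setmul nM).
- have [||||DH|HDN] := simD (H `&` D).
  + exact: closedI.
  + exact: is_subgroupI.
  + by move=> x Nx; split; [exact/MH/NM | exact: ND].
  + split=> [x []//|x y [Hx Dx] Dy]; split.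
      by apply: nHD => //; exact: (sub_setmul nM).
    by rewrite conjgE; case: sD => _ DMl DV; apply/DMl; [exact: DV|exact: DMl].
  + by left; apply: setmul_min => // x /DH[].
  (* Modulo [M], the elements [x] and [y] have representatives in H ∩ D and D, whose commutator lies
     in [N]. *)
  + right=> x y Hx /(setmulP nM)[d Dd dy].
    have /(setmulP nM)[h Dh hx] := HD x Hx.
    apply: (comm_mod hx dy); apply/NM/HDN => //; split => //.
    exact: (subgroup_mod sH MH (esym hx)).
Qed.

Lemma pro_p_mod_setmul p D N M : N `<=` M -> is_normal_subgroup M ->
  pro_p_mod p D N -> pro_p_mod p (setmul D M) M.
Proof.
move=> NM nM pD x /(setmulP nM)[d Dd dx] L oL.
have [n Ln] := pD d Dd L (open_normal_over_trans NM oL); exists n.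
have [_ [sL _] ML] := oL; apply: (subgroup_mod sL ML _ Ln).
by rewrite !(modgX nM) dx.
Qed.

Lemma subnormal_chain_setmul n C M : open M -> is_normal_subgroup M ->
  subnormal_chain n C -> subnormal_chain n (fun i => setmul (C i) M).
Proof.
move=> oM nM [Cn sC cC nC]; split.
- by rewrite Cn setmulT.
- by move=> i; exact: is_subgroup_setmul.
- by move=> i _; exact: closed_setmul.
- by move=> i /nC; exact: normal_in_setmul.
Qed.

End RelativeNotions.

(** * Compactness in profinite groups *)

Section Compactness.
Variable T : topologicalType.

(** A cluster point of the filter generated by the [A j] lies in each of these closed sets. *)
Lemma compact_directed_bigcap (J : Type) (P : set J) (A : J -> set T) :
  compact [set: T] -> P !=set0 ->
  (forall j, P j -> closed (A j)) -> (forall j, P j -> A j !=set0) ->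
  (forall i j, P i -> P j -> exists2 k, P k & A k `<=` A i `&` A j) ->
  (\bigcap_(j in P) A j) !=set0.
Proof.
move=> cT [j0 Pj0] cA A0 dirA.
have FF : ProperFilter (filter_from P A).
  apply: filter_from_proper; last exact: A0.
  by apply: filter_from_filter; [exists j0 | exact: dirA].
have [|p [_ clp]] := cT _ FF; first by exists j0.
exists p => j Pj; apply: (cA j Pj) => B pB.
by apply: clp => //; exists j.
Qed.

(* The intersection Q of the clopen neighbourhoods of a point is connected. *)
Lemma compact_totally_disconnected_zero_dimensional :
  compact [set: T] -> hausdorff_space T -> totally_disconnected [set: T] ->
  zero_dimensional T.
Proof.
move=> cT hT tT x y xy.
pose Q : set T := \bigcap_(D in [set D : set T | clopen D /\ D x]) D.
have Qx : Q x by move=> D [].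
(* Normality separates [A] and [A'] by disjoint open sets [U] and [V]. By compactness some clopen
   [D] around [x] lies in their union; then D ∩ U is clopen too, so it contains [Q]. *)
have core (A A' : set T) : closed A -> closed A' -> A `&` A' = set0 -> A x ->
    Q `<=` A `|` A' -> Q `&` A' = set0.
  move=> cA cA' AA' Ax QAA'.
  have [W [AW WA']] : exists W, set_nbhs A W /\ closure W `<=` ~` A'.
    have /(compact_normal hT cT cA)[W AW WA'] : set_nbhs A (~` A').
      move=> a Aa; apply: open_nbhs_nbhs; split; first exact: closed_openC.
      by move=> A'a; have : (A `&` A') a by []; rewrite AA'.
    by exists W.
  have [U [oU AU UW]] := (set_nbhsP A W).1 AW.
  pose V := ~` closure W.
  have oV : open V by apply: closed_openC; exact: closed_closure.
  have UV : U `<=` ~` V by move=> z /UW/subset_closure; rewrite /V setCK.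
  have [D [[oD cD] Dx] DUV] : exists2 D, (clopen D /\ D x) & D `<=` U `|` V.
    apply: contrapT => nD.
    have [||||z] := @compact_directed_bigcap _
      [set D : set T | clopen D /\ D x] (fun D => D `&` ~` (U `|` V)) cT.
    - by exists setT; split => //; exact: clopenT.
    - move=> D [[_ cD] _]; apply: closedI => //; apply: open_closedC; exact: openU.
    - move=> D DP; apply: contrapT => /nonemptyPn D0; apply: nD; exists D => //.
      by rewrite -subsets_disjoint in D0.
    - move=> D E [clD Dx] [clE Ex]; exists (D `&` E).
        by split; [exact: clopenI | ].
      by move=> z [[? ?] ?].
    - move=> Dz; have /QAA' : Q z by move=> D DP; have [] := Dz D DP.
      have [_ nUV] := Dz setT (conj (@clopenT T) I).
      by case=> [/AU Uz|/(contraPnot (WA' z)) Vz]; apply: nUV; [left|right].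
  have QDU : Q `<=` D `&` U.
    move=> z; apply; split; last by split => //; exact: AU.
    split; first exact: openI.
    rewrite (_ : D `&` U = D `&` ~` V).
      by apply: closedI => //; exact: open_closedC.
    apply/seteqP; split=> w [Dw Uw]; split => //; first exact: UV.
    by have [] := DUV w Dw.
  rewrite -subset0 => z [/QDU[_ Uz] A'z].
  by apply: (UV z Uz); exact: (contraPnot (WA' z)).
apply: contrapT => nU.
have Qy : Q y.
  by move=> D [cD Dx]; apply: contrapT => nDy; apply: nU; exists D.
suff cQ : connected Q.
  have := tT x I; rewrite eqEsubset => -[+ _] => /(_ y) yx.
  by move/eqP: xy; apply; apply/esym/yx; exists Q.
have clQ : closed Q by apply: closed_bigI => D [[]].
move=> B [b Bb] [C1 oC1 BC1] [C2 cC2 BC2].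
have cB : closed B by rewrite BC2; exact: closedI.
have cQB : closed (Q `\` B).
  rewrite BC1 setDIr setDv set0U; apply: closedI => //; exact: open_closedC.
have QB : Q `<=` B `|` (Q `\` B).
  by move=> z Qz; have [|] := pselect (B z); [left|right].
have BQ : B `<=` Q by rewrite BC1 => z [].
(* For [B] relatively clopen in [Q], [core] empties whichever of [B] and its complement in [Q]
   misses [x]. *)
have [Bx|nBx] := pselect (B x).
  apply/seteqP; split => // z Qz; apply: contrapT => nBz.
  have := core B (Q `\` B) cB cQB _ Bx QB; rewrite setDE setICA setICr setI0.
  by move=> /(_ erefl); rewrite -subset0 => /(_ z); apply.
have := core (Q `\` B) B cQB cB _ _ _.
rewrite setUC setDE -setIA setICl setI0 => /(_ erefl) h.
have : (Q `&` B) b by split => //; exact: BQ.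
by rewrite h // -setDE.
Qed.

End Compactness.

(** * Open normal subgroups and limits of subgroup chains *)

Section CompactGroups.
Variable G : topologicalGroupType.
Hypothesis profG : profinite G.
Implicit Types (A B D H K L M N : set G) (x y : G).

Let cG : compact [set: G]. Proof. by case: profG. Qed.

(** Compactness enters as a near-covering property along the filter of large finite sets: the whole
    coset of [x] is covered once the finite set contains [x]. *)
Lemma finite_index M : is_subgroup M -> open M ->
  exists2 A : set G, finite_set A & forall x, exists2 a, A a & M (a^-1 * x).
Proof.
move=> sM oM.
pose F := filter_from (@finite_set G) (fun A => [set B | A `<=` B /\ finite_set B]).
have FF : ProperFilter F.
  apply: filter_from_proper; last by move=> A fA; exists A; split.
  apply: filter_from_filter; first by exists set0; exact: finite_set0.
  move=> A B fA fB; exists (A `|` B); first by rewrite finite_setU.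
  by move=> C [ABC fC]; split; split=> // z Az; apply: ABC; [left|right].
have : \forall A \near F, setT `<=` (fun x => exists2 a, A a & M (a^-1 * x)).
  apply: (iffLR (compact_near_coveringP _) cG _ _
    (fun A x => exists2 a, A a & M (a^-1 * x))) => x _.
  exists ([set y | M (x^-1 * y)], [set B | [set x] `<=` B /\ finite_set B]).
    by split; [exact: nbhs_coset | exists [set x] => //; exact: finite_set1].
  by move=> [y B] /= [Mxy [xB _]]; exists x => //; exact: xB.
move=> FP; have [A [fA AP]] : exists A, finite_set A /\
    setT `<=` (fun x => exists2 a, A a & M (a^-1 * x)).
  have : F (@finite_set G) by exists set0; [exact: finite_set0 | move=> B []].
  by move=> /(filterI FP)/filter_ex[A [? ?]]; exists A.
by exists A => // x; exact: AP.
Qed.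

Lemma open_normal_basis U : nbhs 1 U ->
  exists M, [/\ open M, is_normal_subgroup M & M `<=` U].
Proof.
have [_ hG tG] := profG.
have zG := compact_totally_disconnected_zero_dimensional cG hG tG.
move=> /(zero_dimensional_cvg hG zG cG) [V [V1 [oV cV]] VU].
(* The elements all of whose conjugates stabilise V under right translation;
   this set is open by compactness of G * G. *)
pose M := [set x : G | forall g v : G, V v <-> V (v * x ^ g)].
exists M; split.
- rewrite openE => x Mx.
  have : \forall y \near x, setT `<=` (fun p : G * G => V p.2 <-> V (p.2 * y ^ p.1)).
    have cGG : compact [set: G * G] by rewrite -setXTT; exact: compact_setX.
    apply: (iffLR (compact_near_coveringP _) cGG _ _
      (fun y p => V p.2 <-> V (p.2 * y ^ p.1))) => -[g v] _.
    pose f (z : G * G * G) : G := z.1.2 * z.2 ^ z.1.1.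
    have cf : continuous f.
      apply: continuousM => [z|].
        by apply: (@continuous_comp _ _ _ fst snd); [exact: cvg_fst|exact: cvg_snd].
      apply: continuousJ => z; first exact: cvg_snd.
      by apply: (@continuous_comp _ _ _ fst fst); exact: cvg_fst.
    (* Used for [V] and for its complement, both open: membership of [v] and of [v * x ^ g] in [V]
       is locally constant. *)
    have nearW (W : set G) : open W -> W v -> W (v * x ^ g) ->
        \forall z \near ((g, v), x), W z.1.2 /\ W (f z).
      move=> oW Wv Wvx; apply: filterI.
        apply: (@continuous_comp _ _ _ fst snd ((g, v), x)); first exact: cvg_fst.
          exact: cvg_snd.
        exact: open_nbhs_nbhs.
      by apply: cf; exact: open_nbhs_nbhs.
    have [Vv|nVv] := pselect (V v).
      by apply: filterS (nearW V oV Vv ((Mx g v).1 Vv)) => z [].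
    have nVx : ~ V (v * x ^ g) by move/(Mx g v).
    by apply: filterS (nearW (~` V) (closed_openC cV) nVv nVx) => z [].
  apply: filterS => y Hy g v; exact: (Hy (g, v)).
- split; first split.
  + by move=> g v; rewrite conj1g mulg1.
  + by move=> x y Mx My g v; rewrite conjMg mulgA (Mx g) (My g).
  + by move=> x Mx g v; rewrite (Mx g (v * _)) conjVg mulgVK.
  + by move=> x y Mx g v; rewrite -conjgM.
- by move=> x /(_ 1 1); rewrite mul1g conjg1 => /iffLR/(_ V1)/VU.
Qed.

Section OverClosedNormal.
Variable N : set G.
Hypotheses (cN : closed N) (nN : is_normal_subgroup N).

(** Some coset x M with [M] open normal avoids the closed set [A]; so does x N M, because [A] is a
    union of cosets of [N]. *)
Lemma open_normal_over_coset A x : closed A -> setmul A N = A -> ~ A x ->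
  exists2 M, open_normal_over N M & ~ setmul A M x.
Proof.
move=> cA AN nAx.
have [|M [oM nM MA]] := @open_normal_basis [set y | ~ A (x * y)].
  apply: (@mul_continuousl G x 1 (~` A)); rewrite mulg1.
  by apply: open_nbhs_nbhs; split; [exact: closed_openC|].
exists (setmul N M).
  split; first exact: open_setmul.
    exact: is_normal_subgroup_setmul.
  exact: sub_setmul.
move=> [a Aa [n Nn Mn]]; apply: (MA (x^-1 * (a * n))).
  by case: nM => -[_ _ MV] _; have := MV _ Mn; rewrite !gnorm.
rewrite mulVKg -AN; exists a => //.
by rewrite mulKg.
Qed.

(** Reduces membership in a closed [N]-saturated set to the finite quotients of G / N. *)
Lemma open_normal_over_cap A x : closed A -> setmul A N = A ->
  (forall M, open_normal_over N M -> setmul A M x) -> A x.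
Proof.
move=> cA AN AMx; apply: contrapT => /(open_normal_over_coset cA AN)[M oM].
by apply; exact: AMx.
Qed.

Lemma open_normal_over_capN x : (forall M, open_normal_over N M -> M x) -> N x.
Proof.
move=> Mx; have [sN _] := nN.
apply: open_normal_over_cap => //; first exact: setmul_id.
move=> M oM; have [_ nM _] := oM; apply: (sub_setmulr nM); first by case: sN.
exact: Mx.
Qed.

Lemma open_normal_overT : open_normal_over N setT.
Proof. by split => //; exact: openT. Qed.

(* D i is an ultralimit of the C M i: along an ultrafilter on the open normal
   subgroups M refining all cones below some M0, the image of C M i modulo M0 is
   eventually constant, and compactness of G lifts these images to D i. *)
Lemma limit_chain (C : set G -> nat -> set G) :
  (forall M i, open_normal_over N M -> is_subgroup (C M i)) ->
  exists D : nat -> set G,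
    (forall i, [/\ closed (D i), is_subgroup (D i) & N `<=` D i]) /\
    forall M0 n, open_normal_over N M0 ->
      exists M, [/\ open_normal_over N M, M `<=` M0 &
        forall i, (i < n)%N -> setmul (D i) M0 = setmul (C M i) M0].
Proof.
move=> sC.
pose F0 := filter_from (open_normal_over N)
  (fun M0 => [set M | open_normal_over N M /\ M `<=` M0]).
have FF0 : ProperFilter F0.
  apply: filter_from_proper; last by move=> M oM; exists M; split.
  apply: filter_from_filter; first by exists setT; exact: open_normal_overT.
  move=> M1 M2 oM1 oM2; exists (M1 `&` M2); first exact: open_normal_overI.
  by move=> M [oM MM]; split; split => // z /MM[].
have [U [UU F0U]] := ultraFilterLemma FF0.
have Ucone M0 : open_normal_over N M0 ->
    U [set M | open_normal_over N M /\ M `<=` M0].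
  by move=> oM0; apply: F0U; exists M0.
(* The elements whose class modulo [M0] meets [C M i] for almost all [M] in the sense of [U]. *)
pose L i M0 : set G := [set x | U [set M | setmul (C M i) M0 x]].
(* The ultrafilter decides membership of each single [x]. The decision is the same on the whole
   coset of [x] modulo [M0], so compactness leaves finitely many decisions to intersect. *)
have UL i M0 : open_normal_over N M0 -> U [set M | setmul (C M i) M0 = L i M0].
  move=> oM0; have [opM0 nM0 _] := oM0.
  have : \forall M \near U,
      setT `<=` (fun x => setmul (C M i) M0 x <-> L i M0 x).
    apply: (iffLR (compact_near_coveringP _) cG _ _
      (fun M x => setmul (C M i) M0 x <-> L i M0 x)) => x _.
    pose R := [set M | setmul (C M i) M0 x <-> L i M0 x].
    have UR : U R.
      have [Lx|nLx] := pselect (L i M0 x).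
        by apply: filterS (Lx) => M.
      have [//|] := in_ultra_setVsetC [set M | setmul (C M i) M0 x] UU.
      by apply: filterS => M nMx; split=> //.
    exists ([set y | M0 (x^-1 * y)], R).
      by split => //; apply: nbhs_coset => //; case: nM0.
    move=> [y M] /= [/(modP nM0) xy RM].
    split=> [/(setmul_congr (esym xy))/RM Lx|Ly].
      by apply: filterS Lx => M'; exact: setmul_congr.
    apply: (setmul_congr xy); apply/RM.
    by apply: filterS Ly => M'; exact: setmul_congr.
  by apply: filterS => M HM; apply/seteqP; split=> x; have [] := HM x I.
have ULn n M0 : open_normal_over N M0 -> U [set M | [/\ open_normal_over N M,
    M `<=` M0 & forall i, (i < n)%N -> setmul (C M i) M0 = L i M0]].
  move=> oM0; elim: n => [|n IHn].
    by apply: filterS (Ucone M0 oM0) => M [].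
  apply: filterS (filterI IHn (UL n M0 oM0)) => M [[oM MM0 HM] Hn].
  by split => // i; rewrite ltnS leq_eqVlt => /orP[/eqP->//|]; exact: HM.
have sL i M0 : open_normal_over N M0 -> is_subgroup (L i M0).
  move=> oM0.
  have [M [[oM _] <-]] := filter_ex (filterI (Ucone M0 oM0) (UL i M0 oM0)).
  by have [_ nM0 _] := oM0; apply: is_subgroup_setmul => //; exact: sC.
have clL i M0 : open_normal_over N M0 -> closed (L i M0).
  move=> oM0; have [M <-] := filter_ex (UL i M0 oM0).
  by have [? nM0 _] := oM0; exact: closed_setmul.
have LM i M0 : open_normal_over N M0 -> setmul (L i M0) M0 `<=` L i M0.
  move=> oM0; have [_ nM0 _] := oM0; have [M <-] := filter_ex (UL i M0 oM0).
  by move=> x /(setmulP nM0)[a Ma ax]; exact: setmul_congr Ma.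
have Lmono i M1 M2 : M1 `<=` M2 -> L i M1 `<=` L i M2.
  by move=> M12 x; apply: filterS => M [c Cc cx]; exists c => //; exact: M12.
pose D i : set G := \bigcap_(M0 in open_normal_over N) L i M0.
exists D; split=> [i|M0 n oM0].
  split; first by apply: closed_bigI => M0; exact: clL.
    split=> [M0 /(sL i)[]//|x y Dx Dy M0 oM0|x Dx M0 oM0].
      by have [_ + _] := sL i _ oM0; apply; [exact: Dx | exact: Dy].
    by have [_ _ +] := sL i _ oM0; apply; exact: Dx.
  move=> x Nx M0 oM0; apply: LM => //; have [_ nM0 NM0] := oM0.
  by apply: (sub_setmulr nM0); [case: (sL i _ oM0) | exact: NM0].
suff DL i : setmul (D i) M0 = L i M0.
  have [M [oM MM0 HM]] := filter_ex (ULn n M0 oM0).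
  by exists M; split => // i /HM ->.
have [_ nM0 _] := oM0.
apply/seteqP; split=> [x /(setmul_subset (fun x Dx => Dx M0 oM0))|x Lx].
  exact: LM.
(* A lift of [x] to [D i] is a common point of the sets L i M1 ∩ x M0. Each is non-empty: a single
   [M] computes [L i] modulo both [M0] and M0 ∩ M1, and an element of [C M i] congruent to [x]
   modulo [M0] serves. *)
have [||||d Dd] := @compact_directed_bigcap _ _ (open_normal_over N)
    (fun M1 => L i M1 `&` [set y | M0 (x^-1 * y)]) cG.
- by exists setT; exact: open_normal_overT.
- move=> M1 oM1; apply: closedI; first exact: clL.
  by apply: closed_coset; apply: open_subgroup_closed => //; case: oM0.
- move=> M1 oM1; have oM2 := open_normal_overI oM0 oM1.
  have [M [[oM _] [e0 e2]]] := filter_ex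
    (filterI (Ucone M0 oM0) (filterI (UL i _ oM0) (UL i _ oM2))).
  move: (Lx); rewrite -e0 => -[c Cc cx]; exists c; split.
    apply: (@Lmono i (M0 `&` M1)) => [z []//|]; rewrite -e2.
    by apply: sub_setmul => //; case: oM2.
  by case: nM0 => -[_ _ MV] _; have := MV _ cx; rewrite !gnorm.
- move=> M1 M2 oM1 oM2; exists (M1 `&` M2); first exact: open_normal_overI.
  by move=> z [Lz xz]; split; split => //; apply: Lmono Lz => w [].
- exists d; first by move=> M1 /Dd[].
  have [_ xd] := Dd M0 oM0.
  by case: nM0 => -[_ _ MV] _; have := MV _ xd; rewrite !gnorm.
Qed.

End OverClosedNormal.

End CompactGroups.

(** * A countably based degenerate quotient *)

Section CountableQuotient.
Variable G : topologicalGroupType.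
Hypothesis profG : profinite G.
Implicit Types (A B D H K L M N : set G) (x y : G) (C : nat -> set G).

(** Both conclusions about closed subgroups are checked modulo every open normal [M] over [N], where
    either [D] becomes trivial or its image is quasisimple. *)
Lemma quasisimple_mod_limit D N : closed N -> is_normal_subgroup N ->
  closed D -> is_subgroup D -> N `<=` D ->
  (forall M, open_normal_over N M -> ~ D `<=` M ->
     quasisimple_mod (setmul D M) M) ->
  ~ D `<=` N -> quasisimple_mod D N.
Proof.
move=> cN nN cD sD ND limD nDN; have D1 : D 1 by case: sD.
split=> // [H cH sH NH commH|H cH sH NH HD].
  have nHD : normal_in (H `&` D) D.
    split=> [x []//|x y [Hx Dx] Dy]; have [_ HM _] := sH.
    split; last by have [_ DM DV] := sD; apply/DM; [exact: DV | exact: DM].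
    by rewrite -[x ^ y](mulVKg x); apply: HM => //; exact: commH.
  suff : D `<=` H `&` D by move=> h x /h[].
  move=> x Dx; apply: (open_normal_over_cap profG nN).
  - exact: closedI.
  - apply: setmul_id => //; first exact: is_subgroupI.
    by move=> z Nz; split; [exact: NH | exact: ND].
  move=> M oM; have [opM nM NM] := oM.
  have [DM|nDM] := pselect (D `<=` M).
    apply: (sub_setmulr nM); last exact: DM.
    by split=> //; case: sH.
  have [_ perfD _] := limD M oM nDM.
  apply: (perfD (setmul (H `&` D) M)).
  - exact: closed_setmul.
  - by apply: is_subgroup_setmul => //; exact: is_subgroupI.
  - by apply: (sub_setmulr nM); split=> //; case: sH.
  - move=> u v /(setmulP nM)[a Da au] /(setmulP nM)[b Db bv].
    apply/(setmulP nM); exists [~ a, b]; last by rewrite !modgR au bv.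
    split; first exact: commH.
    have [_ DM DV] := sD; rewrite commgEl conjgE.
    by apply/DM; [exact: DV|apply/DM; [exact: DV|exact/DM]].
  - exact: (sub_setmul nM).
(* If [H] covers [D] modulo every [M], then D lies in H since [H] is closed. If it fails modulo
   [M1], it fails modulo every M ∩ M1, so [H] centralises [D] modulo all of these and hence modulo
   [N]. *)
have [DH|/existsNP[M1 /not_implyP[oM1 nDH]]] := pselect (forall M,
    open_normal_over N M -> D `<=` setmul H M).
  left=> x Dx; apply: (open_normal_over_cap profG nN) => //.
    exact: setmul_id.
  by move=> M oM; exact: DH.
right=> x y Hx Dy; apply: (open_normal_over_capN profG cN nN) => M oM.
suff : (M `&` M1) [~ x, y] by case.
have {oM} oM : open_normal_over N (M `&` M1) by exact: open_normal_overI.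
have nDHM : ~ D `<=` setmul H (M `&` M1).
  move=> h; apply: nDH => z /h[a Ha [_ az]]; exists a => //.
have [opM nM NM] := oM; move: (M `&` M1) => {}M in oM opM nM NM nDHM *.
have H1 : H 1 by case: sH.
have nDM : ~ D `<=` M by move=> DM; apply: nDHM => z /DM; exact: (sub_setmulr nM).
have [_ _ simD] := limD M oM nDM.
have [||||DHM|] := simD (setmul H M).
- exact: closed_setmul.
- exact: is_subgroup_setmul.
- exact: (sub_setmulr nM).
- exact: normal_in_setmul.
- by case: nDHM; apply: subset_trans DHM; exact: (sub_setmul nM).
- by apply; exact: (sub_setmul nM).
Qed.

Lemma pro_p_mod_limit p D N :
  (forall M, open_normal_over N M -> ~ D `<=` M ->
     pro_p_mod p (setmul D M) M) ->
  pro_p_mod p D N.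
Proof.
move=> limD x Dx M oM; have [opM nM NM] := oM.
have [DM|nDM] := pselect (D `<=` M); first by exists 0; rewrite expg1; exact: DM.
apply: (limD M oM nDM); first exact: (sub_setmul nM).
by split.
Qed.

(** * Uniform vanishing of configurations, by compactness *)

Section Step.
Variables (n : nat) (P : set G -> set G -> Prop).

(** A common interface for quasisimple and pro-p sections D / N: [P] passes to non-trivial images,
    and by [limit_property] it is detected on them. *)
Definition push_property := forall D N M, closed D -> is_subgroup D ->
  N `<=` D -> N `<=` M -> open M -> is_normal_subgroup M -> ~ D `<=` M ->
  P D N -> P (setmul D M) M.

Definition limit_property := forall D N, closed N -> is_normal_subgroup N ->
  closed D -> is_subgroup D -> N `<=` D ->
  (forall M, open_normal_over N M -> ~ D `<=` M -> P (setmul D M) M) ->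
  ~ D `<=` N -> P D N.

(** The case [M = N] is the form taken by degeneracy of G / N. *)
Definition bounded_by N M := forall C, subnormal_chain n C -> N `<=` C 0 ->
  P (C 0) N -> C 0 `<=` M.

(** If no [L] worked, each would have a bad chain [c L] surviving modulo the fixed [M]. A limit [D]
    of these chains is a chain over [N] with [P (D 0) N], and it still survives modulo [M], against
    the hypothesis on [N]. *)
Lemma bounded_by_open N M : push_property -> limit_property ->
  closed N -> is_normal_subgroup N -> bounded_by N N -> open_normal_over N M ->
  exists L, [/\ open_normal_over N L, L `<=` M & bounded_by L M].
Proof.
move=> push lim cN nN bN oM; have [opM nM NM] := oM.
apply: contrapT => nL.
have /choice[c cP] : forall L, exists C, open_normal_over N L ->
    [/\ subnormal_chain n C, L `&` M `<=` C 0, P (C 0) (L `&` M) & ~ C 0 `<=` M].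
  (* For all other [L] nothing is demanded and a dummy chain is returned. *)
  move=> L; have [oL|] := pselect (open_normal_over N L);
    last by exists (fun=> setT).
  have : ~ bounded_by (L `&` M) M.
    move=> bL; apply: nL; exists (L `&` M); split => //.
    exact: open_normal_overI.
  move=> /existsNP[C /not_implyP[? /not_implyP[? /not_implyP[? ?]]]].
  by exists C.
have [|D [DP DM]] := limit_chain profG (N := N) (C := c).
  by move=> L i oL; have [[]] := cP L oL.
have {}DM M0 : open_normal_over N M0 -> exists L, [/\ open_normal_over N L,
    L `<=` M0 & forall i, (i <= n)%N -> setmul (D i) M0 = setmul (c L i) M0].
  (* A chain of length [n] has the [n.+1] terms of index 0 to [n]. *)
  by move=> /(DM M0 n.+1).
have Dsat i : setmul (D i) N = D i by have [_ ? ?] := DP i; exact: setmul_id.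
have D1 i : D i 1 by have [_ []] := DP i.
have chainD : subnormal_chain n D.
  split=> [|i|i _|i ltin].
  - apply/seteqP; split=> // x _.
    apply: (open_normal_over_cap profG nN _ (Dsat n)); first by case: (DP n).
    move=> M0 oM0; have [L [oL _ ->//]] := DM M0 oM0.
    have [[-> _ _ _] _ _ _] := cP L oL.
    by have [_ nM0 _] := oM0; rewrite setmulT.
  - by case: (DP i).
  - by case: (DP i).
  - have nDM M0 : open_normal_over N M0 ->
      normal_in (setmul (D i) M0) (setmul (D i.+1) M0).
      move=> oM0; have [L [oL _ eL]] := DM M0 oM0.
      rewrite !eL //; last exact: ltnW.
      have [[_ _ _ nC] _ _ _] := cP L oL.
      by have [_ nM0 _] := oM0; apply: normal_in_setmul => //; exact: nC.
    have cD j : closed (D j) by case: (DP j).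
    split=> [x Dx|x y Dx Dy].
      apply: (open_normal_over_cap profG nN (cD _) (Dsat _)) => M0 oM0.
      have [sub _] := nDM M0 oM0; apply: sub.
      by have [_ nM0 _] := oM0; exact: (sub_setmul nM0).
    apply: (open_normal_over_cap profG nN (cD _) (Dsat _)) => M0 oM0.
    have [_ +] := nDM M0 oM0; have [_ nM0 _] := oM0.
    by apply; exact: (sub_setmul nM0).
(* Modulo [M] itself, [D 0] agrees with some [c L 0], which is not contained in [M]. *)
have D0N : ~ D 0 `<=` N.
  move=> DN; have [L [oL _ /(_ 0 isT) eL]] := DM M oM.
  have [_ _ _ ncM] := cP L oL; apply: ncM => x /(sub_setmul nM).
  rewrite -eL; apply: setmul_min => //; first by case: nM.
  exact: subset_trans NM.
have [cD0 sD0 ND0] := DP 0%N.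
apply: (D0N); apply: bN => //; apply: lim => // M0 oM0 nDM0.
have [L [oL LM0 /(_ 0 isT) eL]] := DM M0 oM0; have [opM0 nM0 NM0] := oM0.
have [[_ sc cc _] Lc Pc ncM] := cP L oL.
(* The image of [D 0] modulo [M0] is the image of [c L 0], which satisfies [P] modulo the smaller L
   ∩ M. *)
rewrite eL; apply: (push _ (L `&` M)) => //; first exact: cc.
  by move=> z [/LM0].
move=> cM0; apply: nDM0 => x /(sub_setmul nM0); rewrite eL.
by apply: setmul_min => //; case: nM0.
Qed.

End Step.

(** * The descending sequence and its intersection *)

Section Sequence.
Variables (n : nat -> nat) (P : nat -> set G -> set G -> Prop).
Hypotheses (push : forall t, push_property (P t))
  (lim : forall t, limit_property (P t)).

Lemma countable_refinement N0 : closed N0 -> is_normal_subgroup N0 ->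
  N0 <> setT -> (forall t, bounded_by (n t) (P t) N0 N0) ->
  exists N, [/\ closed N, is_normal_subgroup N, N <> setT,
    exists2 M : nat -> set G, (forall i, open_normal_over N (M i)) &
      forall U, open U -> N `<=` U -> exists i, M i `<=` U &
    forall t, bounded_by (n t) (P t) N N].
Proof.
move=> cN0 nN0 N0T bN0.
(* Starting from a proper [M0] keeps the final intersection proper. *)
have [M0 oM0 M0T] : exists2 M0, open_normal_over N0 M0 & M0 <> setT.
  have [x nNx] : exists x, ~ N0 x.
    apply: contrapT => h; apply: N0T; apply/seteqP; split=> // x _.
    by apply: contrapT => nNx; apply: h; exists x.
  apply: contrapT => h; apply: nNx; apply: (open_normal_over_capN profG cN0 nN0).
  move=> M oM; apply: contrapT => nMx; apply: h; exists M => // MT.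
  by apply: nMx; rewrite MT.
have /choice[s sP] : forall p : nat * set G, exists L, open_normal_over N0 p.2 ->
    [/\ open_normal_over N0 L, L `<=` p.2 & bounded_by (n p.1) (P p.1) L p.2].
  move=> [t M] /=; have [oM|?] := pselect (open_normal_over N0 M);
    last by exists set0.
  have [L ?] := bounded_by_open (@push t) (@lim t) cN0 nN0 (bN0 t) oM.
  by exists L.
(* The 2-adic valuation of i.+1 takes every value t for infinitely many i. *)
pose M := fix M i := if i is i'.+1 then s (logn 2 i'.+1, M i') else M0.
have oM i : open_normal_over N0 (M i).
  by elim: i => //= i IHi; have [] := sP (logn 2 i.+1, M i) IHi.
have MS i : M i.+1 `<=` M i by have [] := sP (logn 2 i.+1, M i) (oM i).
have Mle i j : (i <= j)%N -> M j `<=` M i.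
  elim: j => [|j IHj]; first by rewrite leqn0 => /eqP->.
  rewrite leq_eqVlt => /orP[/eqP->//|/IHj]; exact: subset_trans.
pose N := \bigcap_i M i.
have NM i : N `<=` M i by move=> x; exact.
have nN : is_normal_subgroup N.
  split; first split.
  - by move=> i _; have [_ [[]]] := oM i.
  - move=> x y Nx Ny i _; have [_ [[_ + _] _] _] := oM i.
    by apply; [exact: Nx | exact: Ny].
  - by move=> x Nx i _; have [_ [[_ _ +] _] _] := oM i; apply; exact: Nx.
  - by move=> x y Nx i _; have [_ [_ +] _] := oM i; apply; exact: Nx.
have clM i : closed (M i).
  by have [opM nM _] := oM i; exact: open_subgroup_closed.
exists N; split=> //.
- exact: closed_bigI.
- move=> NT; apply: M0T; apply/seteqP; split=> // x _.
  by apply: (NM 0%N); rewrite NT.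
- exists M => [i|U oU NU]; first by have [? ? _] := oM i; split.
  (* Otherwise the closed sets M i \ U are non-empty and descending, and compactness gives a point
     of [N] outside [U]. *)
  apply: contrapT => nU.
  have [|||||x Mx] := @compact_directed_bigcap _ _ setT (fun i => M i `&` ~` U).
  + by case: profG.
  + by exists 0%N.
  + by move=> i _; apply: closedI => //; exact: open_closedC.
  + move=> i _; apply: contrapT => /nonemptyPn MU; apply: nU; exists i.
    by rewrite -subsets_disjoint in MU.
  + move=> i j _ _; exists (maxn i j) => // x [Mx Ux].
    by split; split=> //; apply: Mle Mx; rewrite ?leq_maxl ?leq_maxr.
  + by have [_] := Mx 0%N I; apply; apply: NU => i _; have [] := Mx i I.
- move=> t C chC NC PC x Cx j _.
  (* A stage devoted to [t] and not before [j]: [i.+1] has 2-adic valuation exactly [t], and its odd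
     factor makes it larger than [j]. *)
  pose i := (2 ^ t * j.*2.+1).-1.
  have iE : i.+1 = (2 ^ t * j.*2.+1)%N by rewrite prednK // muln_gt0 expn_gt0.
  have it : logn 2 i.+1 = t.
    rewrite iE lognM ?expn_gt0 // pfactorK // lognE /= dvdn2 /= odd_double /=.
    by rewrite addn0.
  have ji : (j <= i)%N.
    rewrite -ltnS iE; apply: (@leq_trans (1 * j.*2.+1)).
      by rewrite mul1n ltnS -addnn leq_addr.
    by rewrite leq_mul2r expn_gt0 orbT.
  have [opM nM _] := oM i.+1.
  (* [push] applies only to a non-trivial image; a trivial one gives the claim at once. *)
  have [CM|nCM] := pselect (C 0 `<=` M i.+1).
    by apply: (Mle j i.+1); [exact: leqW|exact: CM].
  have [_ sC cC _] := chC.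
  apply: (Mle j i) => //.
  have [_ _] := sP (logn 2 i.+1, M i) (oM i); rewrite /= it.
  move=> /(_ (fun k => setmul (C k) (M i.+1))); apply.
  + exact: subnormal_chain_setmul.
  + have [C1 _ _] := sC 0%N.
    by rewrite -[X in s (X, _)]it; exact: (sub_setmulr nM).
  + rewrite -[X in s (X, _)]it; apply: (@push t (C 0) N) => //; exact: cC.
  + exact: (sub_setmul nM).
Qed.

End Sequence.

(** A generated subgroup is trivial exactly when its generators are, so triviality of
    [generalised_fitting] is stated on the generators, pulled back to [G]. *)
Definition degenerate_mod N : Prop :=
  (forall p K, prime p -> closed K -> is_normal_subgroup K -> N `<=` K ->
     pro_p_mod p K N -> K `<=` N) /\
  (forall n C, subnormal_chain n C -> N `<=` C 0 -> ~ quasisimple_mod (C 0) N).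

Theorem countable_degenerate_quotient N0 : closed N0 -> is_normal_subgroup N0 ->
  N0 <> setT -> degenerate_mod N0 ->
  exists N, [/\ closed N, is_normal_subgroup N, N <> setT,
    exists2 M : nat -> set G, (forall i, open_normal_over N (M i)) &
      forall U, open U -> N `<=` U -> exists i, M i `<=` U &
    degenerate_mod N].
Proof.
move=> cN0 nN0 N0T [degp degq].
(* Even indices 2p ask for normal pro-p subgroups, odd ones 2d+1 for subnormal
   quasisimple subgroups of defect at most d. *)
pose n t := if odd t then t./2 else 1%N.
pose P t D N := if odd t then quasisimple_mod D N
  else prime t./2 /\ pro_p_mod t./2 D N.
have [t|t|t|N [cN nN NT cb bN]] := @countable_refinement n P _ _ N0 cN0 nN0 N0T.
- rewrite /push_property /P; case: odd => D N M cD sD ND NM oM nM nDM.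
    exact: quasisimple_mod_setmul.
  by move=> [pr pD]; split=> //; exact: pro_p_mod_setmul pD.
- rewrite /limit_property /P; case: odd => D N cN nN cD sD ND limD nDN.
    exact: quasisimple_mod_limit.
  split; last by apply: pro_p_mod_limit => M oM /(limD M oM)[].
  (* If [t./2] were not prime, [limD] would force [D] into every [M], hence into [N]. *)
  apply: contrapT => npr; apply: nDN => x Dx.
  apply: (open_normal_over_capN profG cN nN) => M oM; apply: contrapT => nMx.
  by have [|] := limD M oM => // DM; apply: nMx; exact: DM.
- rewrite /bounded_by /n /P; case: odd => C chC NC.
    by move=> /(degq _ _ chC NC).
  have [C1 sC cC nC] := chC; have [_ nC0] := nC 0%N isT.
  move=> [pr]; apply: degp => //; first exact: cC.
  by split=> // x y Cx; apply: nC0 => //; rewrite C1.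
- exists N; split=> //; split=> [p K pr cK nK NK pK|d C chC NC qC].
    (* A normal subgroup is the bottom of a chain of length 1. *)
    have := bN p.*2 (fun i => if i is 0 then K else setT).
    rewrite /n /P odd_double doubleK; apply=> //; split=> //.
    + by case=> [|i] //; case: nK.
    + by case=> [|i] // _; exact: closedT.
    + by case=> [|i] // _; split=> // x y Kx _; exact: nK.2.
  have [nCN _ _] := qC; apply: nCN.
  have := bN d.*2.+1 C; rewrite /n /P /= odd_double uphalf_double /=.
  by apply.
Qed.

End CountableQuotient.

(** * Comparison with quotient and subgroup types *)

Section Spaces.

Lemma zero_dimensional_hausdorff (T : topologicalType) :
  zero_dimensional T -> hausdorff_space T.
Proof.
move=> zT x y xy; apply: contrapT => /eqP/zT[U [[oU cU] Ux nUy]].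
have [] := xy U (~` U); first exact: open_nbhs_nbhs.
  by apply: open_nbhs_nbhs; split => //; exact: closed_openC.
by move=> z [].
Qed.

Lemma compact_zero_dimensional_profinite (G : topologicalGroupType) :
  compact [set: G] -> zero_dimensional G -> profinite G.
Proof.
move=> cG zG; split=> //; first exact: zero_dimensional_hausdorff.
exact: zero_dimension_totally_disconnected.
Qed.

Lemma hausdorff_closed1 (G : topologicalGroupType) : hausdorff_space G ->
  closed [set 1 : G].
Proof. by move=> hG; apply: compact_closed => //; exact: compact_set1. Qed.

End Spaces.

Section Quotient.
Variables (G : topologicalGroupType) (N : normal_subgroup G).
Hypothesis profG : profinite G.
Hypothesis cN : closed (N : set G).
Let Q := quotient_group N.
Let pi : G -> Q := @coset G N.
Let nN := normal_is_normal N.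

Let piK (q : Q) : pi (repr q) = q. Proof. exact: coset_reprK. Qed.

Lemma quotient_openE (A : set Q) : open A = open (pi @^-1` A).
Proof. by []. Qed.

Lemma quotient_closedE (A : set Q) : closed A <-> closed (pi @^-1` A).
Proof. by rewrite -!openC. Qed.

Lemma coset_image_preimage (A : set G) :
  (forall x y, A x -> (N : set G) (x^-1 * y) -> A y) -> pi @^-1` (pi @` A) = A.
Proof.
move=> AN; apply/seteqP; split=> [x [a Aa /cosetP]|x Ax]; first exact: AN.
by exists x.
Qed.

(** Distinct points are separated by the image of a coset of some open normal [M] over [N], which is
    clopen in the quotient. *)
Lemma quotient_profinite : profinite Q.
Proof.
have [cG _ _] := profG.
apply: compact_zero_dimensional_profinite.
  have -> : [set: Q] = pi @` [set: G].
    by apply/seteqP; split=> // q _; exists (repr q).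
  apply: continuous_compact => //; apply: continuous_subspaceT.
  exact: coset_continuous.
move=> x y xy.
have nNxy : ~ (N : set G) ((repr x)^-1 * repr y).
  by move/cosetP; rewrite !coset_reprK => /eqP; exact/negP.
have [M [oM nM NM] nMxy] : exists2 M, open_normal_over N M &
    ~ M ((repr x)^-1 * repr y).
  apply: contrapT => h; apply: nNxy.
  apply: (open_normal_over_capN profG cN nN) => M oM.
  by apply: contrapT => nMxy; apply: h; exists M.
pose A := [set z | M ((repr x)^-1 * z)].
have AE : pi @^-1` (pi @` A) = A.
  apply: coset_image_preimage => u v Au /NM uv.
  by have [[_ + _] _] := nM => /(_ _ _ Au uv); rewrite !gnorm.
exists (pi @` A); split.
- split; first by rewrite quotient_openE AE; exact: open_coset.
  apply/quotient_closedE; rewrite AE; apply: closed_coset.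
  exact: open_subgroup_closed.
- exists (repr x) => //; rewrite /A /= mulVg; by case: nM => -[].
- move=> Ay; apply: nMxy; rewrite -[M _]/(A (repr y)) -AE.
  by rewrite /preimage /= piK.
Qed.

(** The images of the cosets of all [M i] form a basis, and each [M i] has finitely many cosets. *)
Lemma quotient_second_countable (M : nat -> set G) :
  (forall i, open_normal_over N (M i)) ->
  (forall U, open U -> (N : set G) `<=` U -> exists i, M i `<=` U) ->
  @second_countable Q.
Proof.
move=> oM MU.
have /choice[A AP] : forall i, exists A : set G, finite_set A /\
    forall x, exists2 a, A a & M i (a^-1 * x).
  move=> i; have [opM [sM _] _] := oM i.
  by have [A ? ?] := finite_index profG sM opM; exists A.
exists (\bigcup_i [set pi @` [set z | M i (a^-1 * z)] | a in A i]).
  apply: bigcup_countable => // i _; apply: finite_set_countable.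
  by apply: finite_image; have [] := AP i.
split.
  by move=> _ [i _ [a _ <-]]; apply: coset_open; apply: open_coset; case: (oM i).
move=> x U /= ; rewrite nbhsE => -[V [oV Vx] VU].
(* Translating by [repr x] turns the preimage of [V] into an open set containing [N]. *)
have [||i MiV] := MU ((fun z => repr x * z) @^-1` (pi @^-1` V)).
- by apply: open_comp => // z _; exact: mul_continuousl.
- move=> n Nn; rewrite /preimage /=.
  suff -> : pi (repr x * n) = x by [].
  rewrite -[RHS]piK; apply/esym/cosetP; by rewrite mulKg.
- have [a Aa Max] := (AP i).2 (repr x); have [_ [[_ MM MV] _] _] := oM i.
  exists (pi @` [set z | M i (a^-1 * z)]).
    by split; [exists i => //; exists a | exists (repr x)].
  move=> _ [z /= Maz <-]; apply: VU.
  have /MiV : M i ((repr x)^-1 * z).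
    by have := MM _ _ (MV _ Max) Maz; rewrite !gnorm.
  by rewrite /preimage /= mulVKg.
Qed.

Lemma quotient_nontrivialP : nontrivial Q <-> (N : set G) <> setT.
Proof.
split=> [[x /eqP x1] NT|NT].
  apply: x1; rewrite -[x]piK; apply/esym/cosetP.
  by rewrite NT.
apply: contrapT => h; apply: NT; apply/seteqP; split=> // x _.
have : pi 1 = pi x.
  by apply: contrapT => /eqP p1x; apply: h; exists (pi x); rewrite eq_sym.
by move/cosetP; rewrite invg1 mul1g.
Qed.

End Quotient.

Section Subgroup.
Variables (G : topologicalGroupType) (H : subgroup G).
Hypothesis profG : profinite G.
Hypothesis cH : closed (H : set G).
Let T := subgroup_type H.

Lemma subgroup_openP (B : set T) :
  open B <-> exists2 A : set G, open A & val @^-1` A = B.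
Proof. by split=> -[A ? <-]; exists A. Qed.

Lemma subgroup_valP (t : T) : (H : set G) (val t).
Proof. by have := valP t; rewrite inE. Qed.

Definition to_subgroup x (Hx : (H : set G) x) : T := Sub x (mem_set Hx).

(** A filter on [H] pushed forward to [G] has a cluster point, which lies in [H] because [H] is
    closed. *)
Lemma subgroup_compact : compact [set: T].
Proof.
have [cG _ _] := profG.
move=> F FF _.
have FV : ProperFilter (val @ F : set_system G) by exact: fmap_proper_filter.
have [|p [_ clp]] := cG (val @ F); first exact: filterT.
have Hp : (H : set G) p.
  apply: cH => B pB.
  have : (val @ F) (H : set G).
    by apply: (@filterS _ F _ setT) => [t _|];
      [exact: subgroup_valP | exact: filterT].
  by move=> /clp/(_ pB).
exists (to_subgroup Hp); split=> // A B FA.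
rewrite nbhsE => -[W [/subgroup_openP[V oV <-] Vp] WB].
have [||z [[t At tz] Vz]] := clp (val @` A) V.
- by apply: (@filterS _ F _ A) => // t At; exists t.
- by apply: open_nbhs_nbhs; split.
by exists t; split=> //; apply: WB; rewrite /preimage /= tz.
Qed.

Lemma subgroup_profinite : profinite T.
Proof.
have [cG hG tG] := profG.
have zG := compact_totally_disconnected_zero_dimensional cG hG tG.
apply: compact_zero_dimensional_profinite; first exact: subgroup_compact.
move=> x y xy; have /zG[U [clU Ux nUy]] : val x != val y.
  by rewrite (inj_eq val_inj).
exists (val @^-1` U); split => //.
apply: preimage_clopen => //; exact: subgroup_val_continuous.
Qed.

Lemma val_image_closed (L : set T) : closed L -> closed (val @` L : set G).
Proof.
rewrite -openC => /subgroup_openP[A oA AL].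
rewrite (_ : val @` L = (H : set G) `&` ~` A).
  by apply: closedI => //; exact: open_closedC.
apply/seteqP; split=> [_ [t Lt <-]|x [Hx nAx]].
  split; first exact: subgroup_valP.
  by move=> At; have : (~` L) t by rewrite -AL.
exists (to_subgroup Hx) => //; apply: contrapT => nL.
by have : (~` L) (to_subgroup Hx) by []; rewrite -AL.
Qed.

End Subgroup.

(** * The centre and quasisimple subgroups *)

Section Center.
Variable G : topologicalGroupType.

Lemma center_closed : hausdorff_space G -> closed (@center_set G).
Proof.
move=> hG; rewrite (_ : @center_set G =
    \bigcap_y ((fun x : G => x^-1 * x ^ y) @^-1` [set 1])).
  apply: closed_bigI => y _; apply: preimage_closed; last exact: hausdorff_closed1.
  move=> x _; apply: continuousM; first exact: invg_continuous.
  by apply: continuousJ => z; [exact: cvg_id | exact: cvg_cst].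
apply/seteqP; split=> [x Zx y _|x Zx y]; last exact/commgP/eqP/Zx.
exact/eqP/commgP/Zx.
Qed.

Lemma commg_central (l z t : G) :
  (forall u, commute z u) -> [~ l * z, t] = [~ l, t].
Proof.
move=> cz; have -> : [~ l * z, t] = z^-1 * (l^-1 * t^-1 * l * (z * t)).
  by rewrite commgEl conjgE !gnorm.
rewrite [z * t]cz [X in z^-1 * X]mulgA -(cz (_ * t)) mulKg.
by rewrite commgEl conjgE !gnorm.
Qed.

End Center.

(** Write T for the subgroup and Z for its centre. For T perfect, simplicity of T / Z amounts to
    non-triviality of T together with every proper closed normal subgroup being central. *)
Lemma quasisimple_subgroupP (G : topologicalGroupType) (H : subgroup G) :
  profinite G -> closed (H : set G) ->
  quasisimple (subgroup_type H) <-> quasisimple_mod (H : set G) [set 1].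
Proof.
move=> profG cH.
pose T := subgroup_type H; pose v : T -> G := val.
have vM x y : v (x * y) = v x * v y by exact: (valM x y).
have vH t : (H : set G) (v t) := subgroup_valP t.
have vsub x (Hx : (H : set G) x) : v (to_subgroup Hx) = x by [].
have vinj : injective v := val_inj.
have v1 := morph1 vM.
have [_ hG _] := profG; have c1 := hausdorff_closed1 hG.
have profT : profinite T := subgroup_profinite profG cH.
have [_ hT _] := profT; have cZ := center_closed hT.
have profQ : profinite (quotient_group (center T)) by exact: quotient_profinite.
have cv : continuous v by exact: subgroup_val_continuous.
pose pi : T -> quotient_group (center T) := @coset T (center T).
have piM x y : pi (x * y) = pi x * pi y by exact: cosetM.
have piS q : pi (repr q) = q by exact: coset_reprK.
have piZ t : pi t = 1 <-> @center_set T t.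
  split=> [/esym/cosetP|Zt]; first by rewrite invg1 mul1g.
  by apply/esym/cosetP; rewrite invg1 mul1g.
have commT1 (x y : T) : commute x y <-> [~ v x, v y] = 1.
  by split=> [/commgP/eqP|] xy; [|apply/commgP/eqP/vinj];
    rewrite -?(morphR vM) ?xy ?v1 ?(morphR vM) // xy.
split=> [[_ perfT [nT simT]]|[nH1 perfH simH]].
- have perfH K : closed K -> is_subgroup K ->
      (forall x y, (H : set G) x -> (H : set G) y -> K [~ x, y]) ->
      (H : set G) `<=` K.
    move=> cK sK commK x Hx.
    pose KT := mk_subgroup (is_subgroup_preimage vM sK).
    suff : (KT : set T) (to_subgroup Hx) by [].
    have : [set: T] (to_subgroup Hx) by [].
    rewrite -perfT; apply; split.
      by apply: preimage_closed => // t _; exact: cv.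
    by move=> _ [t _ [u _ <-]]; rewrite /= /preimage /= (morphR vM); exact: commK.
  split=> [H1|K cK sK _|K cK sK _ [KH nK]]; last 1 first.
  + pose L := v @^-1` K.
    have nL : is_normal_subgroup L.
      split; first exact: is_subgroup_preimage.
      by move=> t u Lt; rewrite /L /preimage /= (morphJ vM); exact: nK.
    have nS : is_normal_subgroup (pi @` L).
      by apply: is_normal_subgroup_image nL => // q; exists (repr q).
    have cL : closed L by apply: preimage_closed => // t _; exact: cv.
    have [|S1|ST] := simT (mk_normal nS).
    * have [cT _ _] := profT; have [_ hQ _] := profQ.
      apply: compact_closed => //; apply: continuous_compact.
        by apply: continuous_subspaceT; exact: coset_continuous.
      exact: subclosed_compact cT _.
    * right=> x y Kx Hy; pose t := to_subgroup (KH x Kx); pose u := to_subgroup Hy.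
      have : (pi @` L) (pi t) by exists t.
      rewrite [X in X _]S1 => /piZ/(_ u)/commT1; exact.
    (* Here T = L Z, so each commutator of T equals one with an entry in the normal subgroup [L]; by
       perfectness L = T. *)
    * left; apply: perfH => // x y Hx Hy.
      pose t := to_subgroup Hx; pose u := to_subgroup Hy.
      have [l Ll /cosetP Zl] : (pi @` L) (pi t) by rewrite [X in X _]ST.
      have -> : [~ x, y] = v [~ t, u] by rewrite (morphR vM).
      have [_ LM LV] := nL.1; rewrite -(mulVKg l t) commg_central //.
      by rewrite commgEl; apply: LM; [exact: LV | exact: nL.2].
  + have [q /eqP] := nT; apply; rewrite -[q]piS; apply/piZ => t.
    by apply/commT1; rewrite (H1 _ (vH (repr q))) comm1g.
  + exact: perfH.
(* A perfect abelian group is trivial; this makes T / Z non-trivial. *)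
- have comm1 : ~ (forall t u : T, commute t u).
    move=> cT; apply: nH1; apply: perfH => //.
      split=> [//|x y -> ->|x ->] /=; first by rewrite mulg1.
      by rewrite invg1.
    by move=> x y Hx Hy; exact: (commT1 (to_subgroup Hx) (to_subgroup Hy)).1.
  split=> //.
  + apply/seteqP; split=> // t _ K [cK commK].
    have sK := subgroup_is_subgroup K.
    have [] := perfH (v @` (K : set T)) _ _ _ _ (v t) (vH t).
    * exact: val_image_closed.
    * exact: is_subgroup_image.
    * by move=> x ->; exists 1 => //; case: sK.
    * move=> x y Hx Hy; exists [~ to_subgroup Hx, to_subgroup Hy].
        by apply: commK; exists (to_subgroup Hx) => //; exists (to_subgroup Hy).
      by rewrite (morphR vM).
    * by move=> u Ku /vinj <-.
  + split=> [|N cN].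
      apply: contrapT => nq; apply: comm1 => t u.
      suff /piZ : pi t = 1 by exact.
      by apply: contrapT => /eqP pt; apply: nq; exists (pi t).
    have sN := normal_is_normal N.
    pose L := pi @^-1` (N : set _).
    have nL : is_normal_subgroup L by exact: is_normal_subgroup_preimage.
    have [||||HL|L1] := simH (v @` L).
    * apply: val_image_closed => //; apply: preimage_closed => // t _.
      exact: coset_continuous.
    * by apply: is_subgroup_image => //; case: nL.
    * by move=> x ->; exists 1 => //; case: nL => -[].
    * split=> [_ [t _ <-]|_ y [t Lt <-] Hy]; first exact: vH.
      exists (t ^ to_subgroup Hy); first exact: nL.2.
      by rewrite (morphJ vM).
    * right; apply/seteqP; split=> // q _.
      have [t Lt /vinj tq] := HL _ (vH (repr q)).
      by rewrite -[q]piS -tq.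
    * left; apply/seteqP; split=> [q Nq|q ->]; last by case: sN => -[].
      rewrite /= -[q]piS; apply/piZ => u; apply/commT1/L1; last exact: vH.
      by exists (repr q) => //; rewrite /L /preimage /= piS.
Qed.

(** * Finite groups of prime power order and pro-p subgroups *)

Section FiniteGroup.
Variables (Q : groupType) (s : seq Q).

(* [mem_s] is a phantom argument from which the enumeration is inferred. *)
Definition enumerated of (forall x, x \in s) : Type := Q.

Variable mem_s : forall x, x \in s.
Local Notation F := (enumerated mem_s).
HB.instance Definition _ := Group.copy F Q.

Lemma index_pcancel : pcancel (fun x : F => index x s) (onth s).
Proof.
by move=> x; rewrite onthE (nth_map x) ?nth_index ?index_mem //; exact: mem_s.
Qed.

HB.instance Definition _ := PCanIsCountable index_pcancel.

Lemma enumeratedP : Finite.axiom (undup s : seq F).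
Proof. by move=> x; rewrite count_uniq_mem ?undup_uniq // mem_undup mem_s. Qed.

HB.instance Definition _ := isFinite.Build F enumeratedP.

Lemma enumerated_card : ([set: Q] #= `I_#|{: F}|)%card.
Proof.
apply/pcard_eqP/bijPex; exists (fun x : F => enum_rank x : nat); split.
- by move=> x _ /=.
- by move=> x y _ _ /val_inj/enum_rank_inj.
- by move=> i /= lti; exists (enum_val (Ordinal lti)) => //; rewrite enum_valK.
Qed.

End FiniteGroup.

Lemma expg_card_eq1 (Q : groupType) (m : nat) (x : Q) :
  ([set: Q] #= `I_m)%card -> x ^+ m = 1.
Proof.
move=> Qm; have fQ : finite_set [set: Q] by apply/finite_setP; exists m.
have [s sE] := (finite_seqP _).1 fQ.
have mem_s y : y \in s by have : [set: Q] y by []; rewrite sE.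
pose F : FinGroup.type := enumerated mem_s.
have <- : #|{: F}| = m.
  by apply/card_eq_II; rewrite -(card_eql (enumerated_card mem_s)).
have := @expg_cardG F (setT_group F) x.
by rewrite cardsT; apply; rewrite inE.
Qed.

(** By Cauchy's theorem a prime [q] dividing the order of [Q] is the order of an element, so it
    divides a power of [p]. *)
Lemma card_eq_prime_power (Q : groupType) (p : nat) :
  finite_set [set: Q] -> prime p ->
  (forall x : Q, exists n, x ^+ (p ^ n)%N = 1) ->
  exists n, ([set: Q] #= `I_(p ^ n))%card.
Proof.
move=> fQ pr_p pQ.
have [s sE] := (finite_seqP _).1 fQ.
have mem_s y : y \in s by have : [set: Q] y by []; rewrite sE.
pose F : FinGroup.type := enumerated mem_s.
suff /p_natP[n Fn] : p.-nat #|{: F}|.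
  by exists n; rewrite -Fn; exact: enumerated_card.
apply/pnatP; first by rewrite -cardsT; exact: cardG_gt0.
move=> q pr_q; rewrite -cardsT => /(Cauchy pr_q)[x _ ox].
have [n xn] := pQ x.
have : (fingroup.order x %| p ^ n)%N by rewrite order_dvdn; apply/eqP.
by rewrite ox Euclid_dvdX // dvdn_prime2 // => /andP[/eqP-> _]; rewrite inE.
Qed.

(** [pro_p] tests the open normal subgroups of [K], [pro_p_mod] those of [G]; every one of the
    former contains the trace on [K] of one of the latter. Lagrange and Cauchy translate between
    orders and elements. *)
Lemma pro_p_subgroupP (G : topologicalGroupType) (K : subgroup G) (p : nat) :
  profinite G -> closed (K : set G) -> prime p ->
  pro_p (subgroup_type K) p <-> pro_p_mod p (K : set G) [set 1].
Proof.
move=> profG cK pr_p; pose T := subgroup_type K; pose v : T -> G := val.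
have vM x y : v (x * y) = v x * v y by exact: (valM x y).
have cv : continuous v by exact: subgroup_val_continuous.
have profT : profinite T := subgroup_profinite profG cK.
split=> [[_ pT] x Kx M [oM nM _]|pK].
  pose t := to_subgroup Kx.
  pose L := mk_normal (is_normal_subgroup_preimage vM nM).
  have oL : open (L : set T) by apply: open_comp => // z _; exact: cv.
  have [n Ln] := pT L oL; exists n.
  have := expg_card_eq1 (coset L t) Ln.
  rewrite -(morphX (@cosetM T L)) => /esym/cosetP; rewrite invg1 mul1g.
  by move=> Lt; have : M (v (t ^+ (p ^ n)%N)) by []; rewrite (morphX vM).
split=> // L oL; have sL := subgroup_is_subgroup L.
apply: card_eq_prime_power => //.
  have [A fA AL] := finite_index profT sL oL.
  apply: (sub_finite_set _ (finite_image (@coset T L) fA)) => q _.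
  have [a Aa La] := AL (repr q); exists a => //.
  by rewrite -[RHS](coset_reprK q); apply/cosetP.
move=> q; have [A oA AL] := (subgroup_openP (L : set T)).1 oL.
have L1 : (L : set T) 1 by case: sL.
have [|M [oM nM MA]] := @open_normal_basis G profG A.
  by apply: open_nbhs_nbhs; split=> //; rewrite -AL in L1.
have [|n Mn] := pK (v (repr q)) (subgroup_valP _) M.
  by split=> // _ ->; case: nM => -[].
exists n; rewrite -[q]coset_reprK -(morphX (@cosetM T L)).
apply/esym/cosetP; rewrite invg1 mul1g -AL /preimage /=; apply: MA.
by rewrite -[val _]/(v _) (morphX vM).
Qed.

(** * Degeneracy expressed on generators *)

Section FittingDegenerate.
Variable G : topologicalGroupType.
Hypothesis profG : profinite G.

Lemma sub_gen (A : set G) : A `<=` gen A.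
Proof. by move=> x Ax H [_ AH]; exact: AH. Qed.

Lemma is_subgroup1 : is_subgroup [set 1 : G].
Proof.
by split=> [//|x y -> ->|x ->]; rewrite /= ?mulg1 ?invg1.
Qed.

Lemma gen_eq1 (A : set G) : gen A = [set 1] <-> A `<=` [set 1].
Proof.
split=> [<-|A1]; first exact: sub_gen.
apply/seteqP; split=> [x|x ->].
  move=> /(_ (mk_subgroup is_subgroup1)); apply; split=> //.
  by apply: hausdorff_closed1; case: profG.
by move=> H _; case: (subgroup_is_subgroup H).
Qed.

Lemma fitting_degenerateP : fitting_degenerate G <-> degenerate_mod [set 1 : G].
Proof.
split=> [/gen_eq1 FL|[degp degq]].
  have F1 x : @fitting G x -> x = 1 by move=> Fx; apply: FL; left.
  have L1 x : @layer G x -> x = 1 by move=> Lx; apply: FL; right.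
  split=> [p K pr_p cK nK _ pK x Kx|n C [Cn sC cC nC] _ qC].
    apply: F1; apply: sub_gen; exists p => //; apply: sub_gen.
    exists (mk_normal nK) => //; split => //.
    exact/pro_p_subgroupP.
  have [nC1 _ _] := qC; apply: nC1 => x Cx; apply: L1; apply: sub_gen.
  exists (mk_subgroup (sC 0%N)) => //; split; first exact: cC.
    by exists n, (fun i => mk_subgroup (sC i)); split.
  by apply/quasisimple_subgroupP => //; exact: cC.
apply/gen_eq1; rewrite subUset; split; apply/subsetP => x.
  rewrite !inE; suff -> : @fitting G = [set 1] by [].
  apply/gen_eq1 => {}x [p pr_p]; suff -> : @p_core G p = [set 1] by [].
  apply/gen_eq1 => {}x [K [cK /(pro_p_subgroupP profG cK pr_p) pK]].
  apply: (degp p K pr_p cK _ _ pK); first exact: normal_is_normal.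
  by move=> _ ->; case: (normal_is_normal K) => -[].
rewrite !inE; suff -> : @layer G = [set 1] by [].
apply/gen_eq1 => {}x [H [cH [n [C [C0 Cn cC nC]]] qH]].
have [] := degq n (fun i => C i : set G).
- by split=> // i; exact: subgroup_is_subgroup.
- by move=> _ ->; case: (subgroup_is_subgroup (C 0%N)).
- by rewrite C0; exact/quasisimple_subgroupP.
Qed.

End FittingDegenerate.

(** * The correspondence between subgroups of G / N and subgroups containing N *)

Section QuotientDegenerate.
Variables (G : topologicalGroupType) (N : normal_subgroup G).
Let Q := quotient_group N.
Let pi : G -> Q := @coset G N.
Let nN := normal_is_normal N.
Implicit Types (A H K M : set G) (B : set Q).

Let piK (q : Q) : pi (repr q) = q. Proof. exact: coset_reprK. Qed.

Let piM x y : pi (x * y) = pi x * pi y. Proof. exact: cosetM. Qed.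

Let piS q : exists x, pi x = q. Proof. by exists (repr q). Qed.

Let pi1 x : pi x = 1 <-> (N : set G) x.
Proof.
split=> [/esym/cosetP|Nx]; first by rewrite invg1 mul1g.
by apply/esym/cosetP; rewrite invg1 mul1g.
Qed.

Lemma coset_imageK A : is_subgroup A -> (N : set G) `<=` A ->
  pi @^-1` (pi @` A) = A.
Proof.
move=> [_ AM _] NA; apply: coset_image_preimage => x y Ax /NA Axy.
by have := AM _ _ Ax Axy; rewrite mulVKg.
Qed.

Lemma sub_preimage B : is_subgroup B -> (N : set G) `<=` pi @^-1` B.
Proof. by move=> [B1 _ _] x /pi1 x1; rewrite /preimage /= x1. Qed.

Lemma sub1_preimage B : B `<=` [set 1] <-> pi @^-1` B `<=` N.
Proof.
split=> [B1 x /B1/pi1//|BN q Bq /=]; rewrite -[q]piK; apply/pi1/BN.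
by rewrite /preimage /= piK.
Qed.

Lemma preimage_subset B B' : pi @^-1` B `<=` pi @^-1` B' -> B `<=` B'.
Proof.
by move=> BB q Bq; rewrite -[q]piK; apply: BB; rewrite /preimage /= piK.
Qed.

Lemma normal_in_preimage B B' :
  normal_in B B' <-> normal_in (pi @^-1` B) (pi @^-1` B').
Proof.
split=> [[BB nB]|[BB nB]]; split.
- by move=> x; exact: BB.
- by move=> x y Bx By; rewrite /preimage /= (morphJ piM); exact: nB.
- exact: preimage_subset.
- move=> q r; rewrite -[q]piK -[r]piK -(morphJ piM); exact: nB.
Qed.

Lemma pro_p_mod_preimage p B :
  pro_p_mod p B [set 1] <-> pro_p_mod p (pi @^-1` B) N.
Proof.
split=> pB x Bx M [oM nM NM].
  have [|n [y My yx]] := pB (pi x) Bx (pi @` M).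
    split; [exact: coset_open | exact: is_normal_subgroup_image |].
    by move=> _ ->; exists 1; [case: nM => -[] | exact: morph1].
  exists n; rewrite -(coset_imageK nM.1 NM) /preimage /= (morphX piM).
  by exists y.
have [||n Mn] := pB (repr x) _ (pi @^-1` M).
- by rewrite /preimage /= piK.
- split; [exact: oM | exact: is_normal_subgroup_preimage |].
  by apply: sub_preimage; case: nM.
- by exists n; move: Mn; rewrite /preimage /= (morphX piM) piK.
Qed.

Lemma quasisimple_mod_preimage B :
  quasisimple_mod B [set 1] <-> quasisimple_mod (pi @^-1` B) N.
Proof.
split=> -[nB1 perfB simB]; split.
- by move/sub1_preimage.
- move=> H cH sH NH commH; have iH := is_subgroup_image piM sH.
  suff BH : B `<=` pi @` H by rewrite -(coset_imageK sH NH) => x; exact: BH.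
  apply: perfB => //.
  + by apply/quotient_closedE; rewrite coset_imageK.
  + by move=> _ ->; case: iH.
  + move=> q r Bq Br; exists [~ repr q, repr r].
      by apply: commH; rewrite /preimage /= piK.
    by rewrite (morphR piM) !piK.
- move=> H cH sH NH nH; have iH := is_subgroup_image piM sH.
  have [||||BH|H1] := simB (pi @` H).
  + by apply/quotient_closedE; rewrite coset_imageK.
  + by [].
  + by move=> _ ->; case: iH.
  + by apply/normal_in_preimage; rewrite coset_imageK.
  + by left; rewrite -(coset_imageK sH NH) => x; exact: BH.
  + right=> x y Hx By; apply/pi1; rewrite (morphR piM).
    by apply: H1 => //; exists x.
- by move=> B1; apply: nB1; exact/sub1_preimage.
- move=> H cH sH H1 commH; apply: preimage_subset; apply: perfB.
  + exact/quotient_closedE.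
  + exact: is_subgroup_preimage.
  + exact: sub_preimage.
  + by move=> x y Bx By; rewrite /preimage /= (morphR piM); exact: commH.
- move=> H cH sH H1 nH.
  have [||||BH|HN] := simB (pi @^-1` H).
  + exact/quotient_closedE.
  + exact: is_subgroup_preimage.
  + exact: sub_preimage.
  + exact/normal_in_preimage.
  + by left; exact: preimage_subset.
  + right=> q r Hq Br; rewrite /= -[q]piK -[r]piK -(morphR piM).
    by apply/pi1/HN; rewrite /preimage /= piK.
Qed.

Lemma quotient_degenerateP :
  degenerate_mod [set 1 : Q] <-> degenerate_mod (N : set G).
Proof.
split=> -[degp degq]; split.
- move=> p K pr_p cK nK NK pK; have KE := coset_imageK nK.1 NK.
  rewrite -KE; apply/sub1_preimage; apply: (degp p) => //.
  + by apply/quotient_closedE; rewrite KE.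
  + exact: is_normal_subgroup_image.
  + by move=> _ ->; exists 1; [case: nK => -[] | exact: morph1].
  + by apply/pro_p_mod_preimage; rewrite KE.
- move=> n C [Cn sC cC nC] NC qC.
  (* The chain ascends from a term containing [N], so image and preimage are mutually inverse on all
     its terms. *)
  have NCi i : (i <= n)%N -> (N : set G) `<=` C i.
    elim: i => // i IHi lti; have [CC _] := nC i lti.
    exact: subset_trans (IHi (ltnW lti)) CC.
  have CE i : (i <= n)%N -> pi @^-1` (pi @` C i) = C i.
    by move=> /NCi; exact: coset_imageK.
  apply: (degq n (fun i => pi @` C i)).
  + split=> [|i|i lein|i lti].
    * by rewrite Cn; apply/seteqP; split=> // q _; exists (repr q).
    * exact: is_subgroup_image.
    * by apply/quotient_closedE; rewrite CE //; exact: cC.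
    * by apply/normal_in_preimage; rewrite !CE //; [exact: nC | exact: ltnW].
  + by move=> _ ->; exists 1; [case: (sC 0%N) | exact: morph1].
  + by apply/quasisimple_mod_preimage; rewrite CE.
- move=> p K pr_p cK nK K1 pK; apply/sub1_preimage; apply: (degp p) => //.
  + exact/quotient_closedE.
  + exact: is_normal_subgroup_preimage.
  + by apply: sub_preimage; case: nK.
  + exact/pro_p_mod_preimage.
- move=> n C [Cn sC cC nC] C1 /quasisimple_mod_preimage.
  apply: (degq n (fun i => pi @^-1` C i)).
  + split=> [|i|i lein|i lti].
    * by rewrite Cn.
    * exact: is_subgroup_preimage.
    * exact/quotient_closedE/cC.
    * exact/normal_in_preimage/nC.
  + exact: sub_preimage.
Qed.

End QuotientDegenerate.

(** * Fitting-degenerate quotients of a profinite group *)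

Lemma quotient_fitting_degenerateP (G : topologicalGroupType)
    (N : normal_subgroup G) : profinite G -> closed (N : set G) ->
  fitting_degenerate (quotient_group N) <-> degenerate_mod (N : set G).
Proof.
move=> profG cN; rewrite -quotient_degenerateP.
exact/fitting_degenerateP/quotient_profinite.
Qed.

Theorem theoremE (G : topologicalGroupType) (profG : profinite G)
    (nregG : ~ fitting_regular G) :
  exists N : normal_subgroup G,
    [/\ closed (N : set G),
        nontrivial (quotient_group N),
        @second_countable (quotient_group N) &
        fitting_degenerate (quotient_group N)].
Proof.
move: nregG => /existsNP[N0 /not_implyP[cN0]].
move=> /not_implyP[/quotient_nontrivialP N0T /contrapT]
 /(quotient_fitting_degenerateP profG cN0) deg0.
have [N [cN nN NT [M oM MU] degN]] :=
  countable_degenerate_quotient profG cN0 (normal_is_normal N0) N0T deg0.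
exists (mk_normal nN); split=> //.
- exact/quotient_nontrivialP.
- exact: (@quotient_second_countable _ (mk_normal nN) profG M oM MU).
- exact/quotient_fitting_degenerateP.
Qed.
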